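(* Let $F\subset\mathrm{Sym}^2(\mathbb{R}^n)$ be a cone subequation, $\Omega\subset\mathbb{R}^n$ a bounded domain, $x_1,\dots,x_k\in\Omega$ distinct, and for each $j$ let $h_j$ be a downward-pointing singular $F$-harmonic of polar type at $x_j$. Let $v,w\in\mathrm{USC}(\overline\Omega\setminus\{x_1,\dots,x_k\})$ with $v$ $F$-subharmonic and $w$ $\tilde F$-subharmonic on $\Omega\setminus\{x_1,\dots,x_k\}$, and suppose that for each $j$ there are constants $c_j,k_j$ with $v\le h_j+c_j$ and $w\le -h_j+k_j$ near $x_j$. If $v+w\le0$ on $\partial\Omega$, then $v+w\le0$ on $\Omega\setminus\{x_1,\dots,x_k\}$.
   Context: A cone subequation is a closed $F\subset\mathrm{Sym}^2(\mathbb{R}^n)$ with $A\in F,P\ge0\Rightarrow A+P\in F$ and $tF=F$ for $t>0$; its dual is $\tilde F=\{A:-A\notin\mathrm{Int}F\}$. For a set $G$ (here $F$ or $\tilde F$), an upper semicontinuous $u:X\to[-\infty,\infty)$ is $G$-subharmonic if for every $x_0\in X$ and every $C^2$ function $\phi$ with $u\le\phi$ near $x_0$ and $u(x_0)=\phi(x_0)$, $D^2\phi(x_0)\in G$. $u$ is $F$-harmonic if finite, continuous, $F$-subharmonic and $-u$ is $\tilde F$-subharmonic. A downward-pointing singular $F$-harmonic of polar type at $x_0$ is a continuous $[-\infty,\infty)$-valued $F$-subharmonic function $h$ on a neighborhood $U$ of $x_0$, $F$-harmonic on $U\setminus\{x_0\}$, with $h(x_0)=-\infty$ and $h>-\infty$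 on $U\setminus\{x_0\}$. *)

(* Defs.v *)
From HB Require Import structures.
From mathcomp Require Import all_boot all_order all_algebra.
From mathcomp Require Import all_classical all_reals all_analysis.
Set Implicit Arguments. Unset Strict Implicit. Unset Printing Implicit Defensive.
Import Order.TTheory GRing.Theory Num.Theory.
Import numFieldNormedType.Exports.
Local Open Scope classical_set_scope.
Local Open Scope ring_scope.

Section Defs.
Variables (R : realType) (n : nat).

Definition symm (A : 'M[R]_n) : Prop := A^T = A.

Definition psd (A : 'M[R]_n) : Prop :=
  symm A /\ forall z : 'rV[R]_n, 0 <= (z *m A *m z^T) 0 0.

Definition cone_subequation (F : set 'M[R]_n) : Prop :=
  [/\ F `<=` symm, closed F,
      (forall A P, F A -> psd P -> F (A + P)) &
      (forall (t : R) A, 0 < t -> F A -> F (t *: A))].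

Definition sym_interior (F : set 'M[R]_n) : set 'M[R]_n :=
  [set A | symm A /\ exists2 e : R, 0 < e &
     forall B, symm B -> `|B - A| < e -> F B].

Definition dual (F : set 'M[R]_n) : set 'M[R]_n :=
  [set A | symm A /\ ~ sym_interior F (- A)].

Definition evec (i : 'I_n) : 'rV[R]_n := delta_mx 0 i.

Definition pder (i : 'I_n) (f : 'rV[R]_n -> R) : 'rV[R]_n -> R :=
  fun x => 'D_(evec i) f x.

Definition C2_near (f : 'rV[R]_n -> R) (x0 : 'rV[R]_n) : Prop :=
  exists U : set 'rV[R]_n, open U /\ U x0 /\
    {in U, continuous f} /\
    (forall i, forall x, U x -> derivable f x (evec i)) /\
    (forall i, {in U, continuous (pder i f)}) /\
    (forall i j x, U x -> derivable (pder j f) x (evec i)) /\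
    (forall i j, {in U, continuous (pder i (pder j f))}).

Definition hessian (f : 'rV[R]_n -> R) (x : 'rV[R]_n) : 'M[R]_n :=
  \matrix_(i, j) pder i (pder j f) x.

Definition usc_on (S : set 'rV[R]_n) (u : 'rV[R]_n -> \bar R) : Prop :=
  (forall x, S x -> u x != +oo%E) /\
  forall x0, S x0 -> forall t : R, (u x0 < t%:E)%E ->
    \forall x \near x0, S x -> (u x < t%:E)%E.

Definition subharmonic (G : set 'M[R]_n) (X : set 'rV[R]_n)
    (u : 'rV[R]_n -> \bar R) : Prop :=
  usc_on X u /\
  forall x0, X x0 -> forall phi : 'rV[R]_n -> R, C2_near phi x0 ->
    (\forall x \near x0, X x -> (u x <= (phi x)%:E)%E) ->
    u x0 = (phi x0)%:E -> G (hessian phi x0).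

Definition harmonic (F : set 'M[R]_n) (X : set 'rV[R]_n)
    (u : 'rV[R]_n -> \bar R) : Prop :=
  [/\ (forall x, X x -> u x \is a fin_num),
      (forall x, X x -> {for x, continuous u}),
      subharmonic F X u &
      subharmonic (dual F) X (fun x => - u x)%E].

Definition singular_polar (F : set 'M[R]_n) (x0 : 'rV[R]_n)
    (U : set 'rV[R]_n) (h : 'rV[R]_n -> \bar R) : Prop :=
  open U /\ U x0 /\
  (forall x, U x -> {for x, continuous h}) /\
  subharmonic F U h /\
  harmonic F (U `\ x0) h /\
  h x0 = -oo%E /\
  (forall x, U x -> x != x0 -> h x != -oo%E).

End Defs.

(* Main.v *)
(* For s > 0 the cone property makes (1 + s) v again F-subharmonic, and near x_j
   the sum (1 + s) v + w is at most s h_j + O(1), which tends to -oo. Hence small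
   balls around the poles can be removed and everything reduces, as s -> 0, to
   the comparison principle for F on a compact set.

   That principle is proved by doubling variables. Alexandrov's theorem and
   Jensen's lemma are replaced by a finite argument: it is enough to find one
   contact point and one small radius s at which a C^{1,1} regularization of w
   is within d s^2 of a quadratic polynomial. The mean squares of its second
   differences over dyadic scales form an almost monotone bounded sequence, so
   at some scale the third differences are small on most of the grid, whereas
   the contact points occupy a fixed proportion of the cells at every scale. *)

Require Import Defs.
From HB Require Import structures.
From mathcomp Require Import all_boot all_order all_algebra.
From mathcomp Require Import all_classical all_reals all_analysis.
From mathcomp Require Import ring lra zify.
Set Implicit Arguments. Unset Strict Implicit. Unset Printing Implicit Defensive.
Import Order.TTheory GRing.Theory Num.Theory.
Import numFieldNormedType.Exports.
Local Open Scope classical_set_scope.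
Local Open Scope ring_scope.

(** A single ball with a fixed error suffices because an approximate touching becomes exact at a
    small cost: if a quadratic bounds a function from above up to d s^2 on a ball of radius s and
    agrees with it at the centre, adding 4 d I to the Hessian produces a true touching point inside
    the ball. Replacing v by v + t |x|^2 / 2 creates a margin t in the Hessian that pays for this,
    so the tolerance d is known before the scale s is sought. The obstacle is that the ball must be
    centred at a contact point, whereas the estimate of third differences only concerns averages.
    Tilting the doubled function by linear terms p from a box yields a family of contact points, and
    p is a Lipschitz function of its contact point; this is what prevents the contact points from
    crowding into few cells. *)

(** * The Euclidean dot product of row vectors *)

Section Dot.
Variables (R : realFieldType) (n : nat).
Implicit Types (x y z : 'rV[R]_n) (A : 'M[R]_n).

Definition dot x y : R := \sum_i x 0 i * y 0 i.

Lemma dotC x y : dot x y = dot y x.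
Proof. by apply: eq_bigr => i _; rewrite mulrC. Qed.

Lemma dotDl x y z : dot (x + y) z = dot x z + dot y z.
Proof. by rewrite -big_split; apply: eq_bigr => i _; rewrite !mxE mulrDl. Qed.

Lemma dotZl c x y : dot (c *: x) y = c * dot x y.
Proof. by rewrite mulr_sumr; apply: eq_bigr => i _; rewrite !mxE mulrA. Qed.

Lemma dotNl x y : dot (- x) y = - dot x y.
Proof. by rewrite -scaleN1r dotZl mulN1r. Qed.

Lemma dotDr x y z : dot z (x + y) = dot z x + dot z y.
Proof. by rewrite dotC dotDl !(dotC z). Qed.

Lemma dotZr c x y : dot x (c *: y) = c * dot x y.
Proof. by rewrite dotC dotZl dotC. Qed.

Lemma dotNr x y : dot x (- y) = - dot x y.
Proof. by rewrite dotC dotNl dotC. Qed.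

Lemma dot0l x : dot 0 x = 0.
Proof. by rewrite -(scale0r 0) dotZl mul0r. Qed.

Lemma dot0r x : dot x 0 = 0.
Proof. by rewrite dotC dot0l. Qed.

Definition dotE := (dotDl, dotDr, dotNl, dotNr, dotZl, dotZr, dot0l, dot0r).

Lemma dot_ge0 x : 0 <= dot x x.
Proof. by apply: sumr_ge0 => i _; rewrite -expr2 sqr_ge0. Qed.

Lemma dot_deltar x i : dot x (delta_mx 0 i) = x 0 i.
Proof.
rewrite /dot (bigD1 i) //= big1 ?addr0 ?mxE ?eqxx ?mulr1 // => j /negPf ji.
by rewrite mxE eqxx ji mulr0.
Qed.

Lemma sqr_coord_le_dot x i : x 0 i ^+ 2 <= dot x x.
Proof.
rewrite /dot (bigD1 i) //= expr2 lerDl; apply: sumr_ge0 => j _.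
by rewrite -expr2 sqr_ge0.
Qed.

Lemma dot_le x y a b : (forall i, `|x 0 i| <= a) -> (forall i, `|y 0 i| <= b) ->
  `|dot x y| <= n%:R * (a * b).
Proof.
move=> xa yb; apply: le_trans (ler_norm_sum _ _ _) _.
rewrite -[n in leRHS]card_ord -sum1_card natr_sum mulr_suml.
apply: ler_sum => i _; rewrite mul1r normrM.
by apply: ler_pM.
Qed.

Lemma dot_convex_comb (l : R) x y :
  dot ((1 - l) *: x + l *: y) ((1 - l) *: x + l *: y) =
  (1 - l) * dot x x + l * dot y y - l * (1 - l) * dot (x - y) (x - y).
Proof. rewrite !dotE (dotC y x). ring. Qed.

Lemma dot_symm_mx A x y : A^T = A -> dot (x *m A) y = dot (y *m A) x.
Proof.
move=> sA; have dE u v : dot u v = (u *m v^T) 0 0.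
  by rewrite !mxE; apply: eq_bigr => i _; rewrite !mxE.
by rewrite !dE -[x *m A *m y^T]trmxK [in LHS]mxE !trmx_mul trmxK sA mulmxA.
Qed.

Lemma mx11_dot A x : (x *m A *m x^T) 0 0 = dot (x *m A) x.
Proof. by rewrite mxE; apply: eq_bigr => i _; congr (_ * _); rewrite mxE. Qed.

Lemma dot_scalar_mx c x y : dot (x *m c%:M) y = c * dot x y.
Proof. by rewrite mul_mx_scalar dotZl. Qed.

Lemma dot_delta_mx A i j : dot (delta_mx 0 i *m A) (delta_mx 0 j) = A i j.
Proof. by rewrite dot_deltar -rowE mxE. Qed.

End Dot.

(** * Second differences on lattices *)

Section NatVec.
Variables (n : nat).
Implicit Types u v : {ffun 'I_n -> nat}.

Definition unitv (i : 'I_n) : {ffun 'I_n -> nat} := [ffun j => (j == i : nat)].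

Definition total u : nat := (\sum_i u i)%N.

Lemma addvE u v i : (u + v) i = (u i + v i)%N.
Proof. by rewrite ffunE. Qed.

Lemma totalD u v : total (u + v) = (total u + total v)%N.
Proof. by rewrite -big_split; apply: eq_bigr => i _; rewrite addvE. Qed.

Lemma totalMn u k : total (u *+ k) = (total u * k)%N.
Proof.
elim: k => [|k IH]; last by rewrite mulrSr totalD IH mulnS addnC.
by rewrite mulr0n muln0 /total big1 // => i _; rewrite ffunE.
Qed.

Lemma total_unitv i : total (unitv i) = 1%N.
Proof.
rewrite /total (bigD1 i) //= big1 ?ffunE ?eqxx // => j /negPf ji.
by rewrite ffunE ji.
Qed.

Lemma total_le u W : (forall i, (u i <= W)%N) -> (total u <= n * W)%N.
Proof.
move=> uW; rewrite -[n in leqRHS]card_ord -sum_nat_const.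
by apply: leq_sum => i _; apply: uW.
Qed.

Lemma natvec_ind (P : {ffun 'I_n -> nat} -> Prop) :
  P 0 -> (forall u i, P u -> P (u + unitv i)) -> forall u, P u.
Proof.
move=> P0 PS u; have [k] := ubnP (total u); elim: k u => // k IH u.
case: (pickP (fun i => 0 < u i)%N) => [i ui | u0] uk; last first.
  suff -> : u = 0 by [].
  by apply/ffunP => i; rewrite ffunE; have := u0 i; case: (u i).
have uE : u = [ffun j => (u j - (j == i))%N] + unitv i.
  apply/ffunP => j; rewrite addvE !ffunE; case: eqP => [->|_] /=.
    by rewrite subnK.
  by rewrite subn0 addn0.
rewrite uE; apply/PS/IH; move: uk.
by rewrite {1}uE totalD total_unitv addn1 ltnS.
Qed.

End NatVec.

Section Lattice.
Variables (R : realFieldType) (n : nat).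
Implicit Types (u v : {ffun 'I_n -> nat}) (x : 'rV[R]_n) (f g : 'rV[R]_n -> R).

Definition natrow u : 'rV[R]_n := \row_i (u i)%:R.

Lemma natrowD u v : natrow (u + v) = natrow u + natrow v.
Proof. by apply/rowP => i; rewrite !mxE addvE natrD. Qed.

Lemma natrow0 : natrow 0 = 0.
Proof. by apply/rowP => i; rewrite !mxE ffunE. Qed.

Lemma natrowMn u k : natrow (u *+ k) = k%:R *: natrow u.
Proof.
elim: k => [|k IH]; first by rewrite mulr0n natrow0 scale0r.
by rewrite mulrSr natrowD IH -natr1 scalerDl scale1r.
Qed.

Lemma natrow_unitv i : natrow (unitv i) = delta_mx 0 i.
Proof. by apply/rowP => j; rewrite !mxE ffunE eqxx. Qed.

Definition fdiff (a : 'rV[R]_n) f : 'rV[R]_n -> R := fun x => f (x + a) - f x.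

Lemma fdiffC a b f x : fdiff a (fdiff b f) x = fdiff b (fdiff a f) x.
Proof. by rewrite /fdiff [x + a + b]addrAC; ring. Qed.

(** A monotone lattice path from 0 to u has [total u] edges, hence at most n W; [c] is asked only of
    edges with both ends in the box. *)
Lemma grid_path f x h c W :
  0 <= c ->
  (forall u i, (forall j, (u + unitv i)%R j <= W)%N ->
    `|fdiff (h *: delta_mx 0 i) f (x + h *: natrow u)| <= c) ->
  forall u, (forall j, (u j <= W)%N) ->
  `|f (x + h *: natrow u) - f x| <= (n * W)%:R * c.
Proof.
move=> c0 fc u uW; apply: le_trans (_ : (total u)%:R * c <= _); last first.
  by rewrite ler_wpM2r // ler_nat; apply: total_le.
elim/natvec_ind: u uW => [|u i IH] uW.
  by rewrite natrow0 scaler0 addr0 subrr normr0 mulr_ge0.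
have uW' j : (u j <= W)%N.
  by apply: leq_trans (uW j); rewrite addvE leq_addr.
have {}IH := IH uW'; have := fc u i uW.
rewrite /fdiff natrowD scalerDr addrA natrow_unitv totalD total_unitv natrD.
by move=> {}fc; apply: le_trans (ler_distD (f (x + h *: natrow u)) _ _) _; lra.
Qed.

End Lattice.

(** * Averages over a lattice box *)

Section LatticeMean.
Variables (R : realFieldType) (n N : nat) (x0 : 'rV[R]_n) (h : R).
Implicit Types (f g : 'rV[R]_n -> R) (z : {ffun 'I_n -> 'I_N}).

Definition gridpt z : 'rV[R]_n :=
  x0 + h *: natrow R [ffun i => z i : nat].

Definition gmean f : R := (N%:R ^+ n)^-1 * \sum_z f (gridpt z).

Hypothesis N_gt0 : (0 < N)%N.

Let N0 : 0 < N%:R :> R. Proof. by rewrite ltr0n. Qed.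
Let Nn0 : 0 < N%:R ^+ n :> R. Proof. exact: exprn_gt0. Qed.

Lemma gmean_cst c : gmean (fun=> c) = c.
Proof.
rewrite /gmean sumr_const card_ffun !card_ord -[c *+ _]mulr_natl natrX mulKf //.
by rewrite gt_eqF.
Qed.

Lemma gmeanD f g : gmean (fun x => f x + g x) = gmean f + gmean g.
Proof. by rewrite /gmean big_split mulrDr. Qed.

Lemma gmeanZ c f : gmean (fun x => c * f x) = c * gmean f.
Proof. by rewrite /gmean -mulr_sumr mulrCA. Qed.

Lemma gmean_sum (I : finType) (f : I -> 'rV[R]_n -> R) :
  gmean (fun x => \sum_i f i x) = \sum_i gmean (f i).
Proof. by rewrite /gmean exchange_big mulr_sumr. Qed.

Lemma le_gmean f g : (forall x, f x <= g x) -> gmean f <= gmean g.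
Proof.
move=> fg; rewrite ler_wpM2l ?invr_ge0 ?(ltW Nn0) //.
by apply: ler_sum => z _; apply: fg.
Qed.

(** Overwriting coordinate i by an arbitrary value maps pairs (value, point of the slice)
    injectively into the grid. *)
Lemma card_slice (i : 'I_n) (l : 'I_N) :
  (N * #|[set z : {ffun 'I_n -> 'I_N} | z i == l]%SET| <= N ^ n)%N.
Proof.
set S := finset _.
have -> : (N ^ n = #|[set: {ffun 'I_n -> 'I_N}]%SET|)%N.
  by rewrite cardsT card_ffun !card_ord.
have -> : (N * #|S| = #|finset.setX [set: 'I_N]%SET S|)%N.
  by rewrite cardsX cardsT card_ord.
pose F (p : 'I_N * {ffun 'I_n -> 'I_N}) :=
  [ffun j => if j == i then p.1 else p.2 j].
apply: (@leq_trans #|imset F (mem (finset.setX [set: 'I_N]%SET S))|).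
  rewrite card_in_imset // => -[a z] [b y].
  rewrite !inE /= => /eqP zi /eqP yi /ffunP e.
  congr pair; first by have := e i; rewrite !ffunE eqxx.
  apply/ffunP => j; have := e j; rewrite !ffunE.
  by case: eqP => [->|//]; rewrite zi yi.
exact: subset_leq_card (finset.subsetT _).
Qed.

(* The cyclic shift of the i-th coordinate permutes the grid, and agrees with
   the translation except on the last slice. *)
Lemma gmean_shift_unit f B i : (forall x, `|f x| <= B) ->
  `|gmean (fun x => f (x + h *: delta_mx 0 i)) - gmean f| <= 2 * B / N%:R.
Proof.
move=> fB; have B0 : 0 <= B by apply: le_trans (fB 0).
pose s z : {ffun 'I_n -> 'I_N} := [ffun j => if j == i then ordS (z j) else z j].
have s_inj : injective s.
  move=> z y /ffunP e; apply/ffunP => j; have := e j; rewrite !ffunE.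
  by case: eqP => // _ /ordS_inj.
have lN : (N.-1 < N)%N by rewrite prednK.
pose S := [set z : {ffun 'I_n -> 'I_N} | z i == Ordinal lN]%SET.
rewrite /gmean -mulrBr normrM gtr0_norm ?invr_gt0 // ler_pdivrMl //.
rewrite [X in _ - X](reindex_inj s_inj) /= -sumrB.
apply: le_trans (ler_norm_sum _ _ _) _.
apply: le_trans (_ : \sum_(z in S) 2 * B <= _).
  rewrite [leRHS]big_mkcond; apply: ler_sum => z _; rewrite inE.
  case: eqP => [_|zi].
    by apply: le_trans (ler_normB _ _) _; rewrite mulr_natl; apply: lerD.
  suff -> : gridpt (s z) = gridpt z + h *: delta_mx 0 i by rewrite subrr normr0.
  rewrite /gridpt -addrA -scalerDr -natrow_unitv -natrowD; congr (_ + _ *: natrow _ _).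
  apply/ffunP => j; rewrite addvE !ffunE; case: eqP => [->|_] /=; last by rewrite addn0.
  rewrite addn1 modn_small //.
  have := ltn_ord (z i); rewrite -[X in (_ < X)%N -> _](prednK N_gt0) ltnS leq_eqVlt.
  case/predU1P => [e|]; last by rewrite -ltnS prednK.
  by case: zi; apply: val_inj.
rewrite sumr_const -[leLHS]mulr_natr mulrCA.
rewrite ler_wpM2l ?mulr_ge0 // ler_pdivlMr // mulrC -natrM -natrX ler_nat.
exact: card_slice.
Qed.

Lemma gmean_shift f B u : (forall x, `|f x| <= B) ->
  `|gmean (fun x => f (x + h *: natrow R u)) - gmean f| <=
    2 * B / N%:R * (total u)%:R.
Proof.
move=> fB; elim/natvec_ind: u => [|u i IH].
  under [X in gmean X]eq_fun do rewrite natrow0 scaler0 addr0.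
  rewrite subrr normr0 !mulr_ge0 ?invr_ge0 ?ler0n //.
  exact: le_trans (fB 0).
have fB' x : `|f (x + h *: natrow R u)| <= B by [].
have := gmean_shift_unit i fB'.
under [X in gmean X - _]eq_fun do
  rewrite -addrA -scalerDr [_ + natrow R u]addrC -natrow_unitv -natrowD.
move=> unit_step; rewrite totalD total_unitv natrD mulrDr mulr1.
apply: le_trans (ler_distD (gmean (fun x => f (x + h *: natrow R u))) _ _) _.
by rewrite [leRHS]addrC lerD.
Qed.

End LatticeMean.

(** * Mean squares of second differences over dyadic scales *)

Section Energy.
Variables (R : realFieldType) (n : nat).
Implicit Types (u v d e o : {ffun 'I_n -> nat}) (x y a b : 'rV[R]_n).
Implicit Types (f g G : 'rV[R]_n -> R).

(* Two-sided semiconvexity: G is C^{1,1} with constant 2 L, stated without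
   derivatives. *)
Definition C11_bound (L : R) G := forall l x y, 0 <= l <= 1 ->
  `|G ((1 - l) *: x + l *: y) - ((1 - l) * G x + l * G y)|
    <= L * (l * (1 - l) * dot (x - y) (x - y)).

(** The segments from x to x + a + b and from x + a to x + b share their midpoint; compare G with
    both chords at l = 1/2 and use |a + b|^2 + |a - b|^2 = 2 |a|^2 + 2 |b|^2. *)
Lemma fdiff2_bound L G a b x : C11_bound L G ->
  `|fdiff a (fdiff b G) x| <= L * (dot a a + dot b b).
Proof.
move=> GL; have half : 0 <= (2^-1 : R) <= 1 by lra.
have := GL _ x (x + a + b) half; have := GL _ (x + a) (x + b) half.
have -> : (1 - 2^-1) *: (x + a) + 2^-1 *: (x + b) =
          (1 - 2^-1) *: x + 2^-1 *: (x + a + b).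
  by rewrite !scalerDr !scalerBl !scale1r -!addrA; apply/rowP => i; rewrite !mxE; lra.
rewrite (_ : x + a - (x + b) = a - b); last first.
  by apply/rowP => i; rewrite !mxE; ring.
rewrite (_ : x - (x + a + b) = - (a + b)); last first.
  by apply/rowP => i; rewrite !mxE; ring.
rewrite !dotE (dotC b a) /fdiff !ler_norml; set m := G (_ + _ *: _).
set p := dot a a; set q := dot b b; set r := dot a b.
move=> /andP[h1 h2] /andP[h3 h4]; apply/andP; split; lra.
Qed.

Definition diff2 G (h : R) d e : 'rV[R]_n -> R :=
  fun x => fdiff (h *: natrow R d) (fdiff (h *: natrow R e) G) x / h ^+ 2.

(** Not divided by a further [h]: the oscillation over one step of the normalized second difference
    is comparable across scales. *)
Definition diff3 G h d e : 'rV[R]_n -> R := fdiff (h *: natrow R d) (diff2 G h d e).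

Lemma diff2_double G h d e x : diff2 G (2 * h) d e x =
  4^-1 * (diff2 G h d e x + diff2 G h d e (x + h *: natrow R d) +
   (diff2 G h d e (x + h *: natrow R e)
    + diff2 G h d e (x + h *: natrow R d + h *: natrow R e))).
Proof.
rewrite /diff2 exprMn invfM -natrX.
set a := h *: natrow R d; set b := h *: natrow R e.
have -> : (2 * h) *: natrow R d = a + a by rewrite mulr_natl mulr2n scalerDl.
have -> : (2 * h) *: natrow R e = b + b by rewrite mulr_natl mulr2n scalerDl.
rewrite /fdiff.
rewrite !addrA ![x + b + a]addrAC ![x + a + b + a]addrAC.
by ring.
Qed.

Lemma diff2_bound L G h d e x : 0 < h -> C11_bound L G ->
  `|diff2 G h d e x| <=
    L * (dot (natrow R d) (natrow R d) + dot (natrow R e) (natrow R e)).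
Proof.
move=> h0 GL; have := fdiff2_bound (h *: natrow R d) (h *: natrow R e) x GL.
rewrite /diff2 normrM [`|(_ ^+ 2)^-1|]ger0_norm ?invr_ge0 ?sqr_ge0 //.
by rewrite ler_pdivrMr ?exprn_gt0 // => /le_trans; apply; rewrite !dotE; lra.
Qed.

Lemma natrow_scale h u m : (2 ^+ m * h) *: natrow R u = h *: natrow R (u *+ (2 ^ m)).
Proof. by rewrite natrowMn scalerA natrX mulrC. Qed.

Variables (N : nat) (x0 : 'rV[R]_n) (h : R).
Hypotheses (N_gt0 : (0 < N)%N) (h_gt0 : 0 < h).
Local Notation mean := (gmean N x0 h).

Let sc m := 2 ^+ m * h.

Let shift_le f B u m : (forall x, `|f x| <= B) ->
  `|mean (fun x => f (x + sc m *: natrow R u)) - mean f| <=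
    2 * B / N%:R * ((total u)%:R * 2 ^+ m).
Proof.
move=> fB; rewrite /sc natrow_scale -[2 ^+ m]natrX -natrM -totalMn.
exact: gmean_shift.
Qed.

(* The second difference at scale 2 t is an average of four second differences
   at scale t, so by the parallelogram identity the mean square drops by what
   the third difference contributes; the last term is the boundary effect of
   translating the averaging window. *)
Lemma energy_step G B d e m :
  (forall x, `|diff2 G (sc m) d e x| <= B) ->
  4^-1 * mean (fun x => diff3 G (sc m) d e x ^+ 2) <=
  mean (fun x => diff2 G (sc m) d e x ^+ 2)
  - mean (fun x => diff2 G (sc m.+1) d e x ^+ 2)
  + (total d + total e)%:R * B ^+ 2 / N%:R * 2 ^+ m.
Proof.
move=> aB; pose a := diff2 G (sc m) d e.
pose u := sc m *: natrow R d; pose v := sc m *: natrow R e.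
pose c x := 2^-1 * (a x + a (x + u)).
have cB x : `|c x| <= B.
  have := aB x; have := aB (x + u); rewrite -/a /c !ler_norml.
  by move=> /andP[? ?] /andP[? ?]; apply/andP; split; lra.
have sqB f : (forall x, `|f x| <= B) -> forall x, `|f x ^+ 2| <= B ^+ 2.
  move=> fB x; rewrite normrX; apply: lerXn2r; rewrite ?nnegrE //.
  exact: le_trans (fB x).
have /ler_normlW sd := shift_le d m (sqB _ aB).
have /ler_normlW se := shift_le e m (sqB _ cB).
have E1 : mean (fun x => c x ^+ 2) = 2^-1 * mean (fun x => a x ^+ 2) +
   2^-1 * mean (fun x => a (x + u) ^+ 2)
   - 4^-1 * mean (fun x => diff3 G (sc m) d e x ^+ 2).
  rewrite -mulNr -!gmeanZ -!gmeanD; congr gmean; apply/funext => x.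
  by rewrite /diff3 /fdiff -/a -/u /c; field.
(* In the direction [e] convexity of the square is enough; the gain comes from the direction [d]. *)
have E2 : mean (fun x => diff2 G (sc m.+1) d e x ^+ 2) <=
    2^-1 * mean (fun x => c x ^+ 2) + 2^-1 * mean (fun x => c (x + v) ^+ 2).
  rewrite -!gmeanZ -!gmeanD; apply: le_gmean => // x.
  have -> : diff2 G (sc m.+1) d e x = 2^-1 * (c x + c (x + v)).
    rewrite /sc exprS -mulrA diff2_double -/(sc m) -/a -/u -/v /c.
    by rewrite [x + v + u]addrAC; field.
  by have := sqr_ge0 (c x - c (x + v)); nra.
rewrite natrD; move: sd se; rewrite -/u -/v -/a.
have -> : 2 * B ^+ 2 / N%:R * ((total d)%:R * 2 ^+ m) =
  2 * ((total d)%:R * B ^+ 2 / N%:R * 2 ^+ m) by ring.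
have -> : 2 * B ^+ 2 / N%:R * ((total e)%:R * 2 ^+ m) =
  2 * ((total e)%:R * B ^+ 2 / N%:R * 2 ^+ m) by ring.
rewrite !mulrDl; lra.
Qed.

(** The energies telescope, and the boundary terms form a geometric series bounded by b 2^M <= b N.
    With at most 3 unit steps in [d] and [e] together, 16 = 4 (1 + 3). *)
Lemma energy_sum G B d e M : (2 ^ M <= N)%N ->
  (total d <= 2)%N -> (total e <= 1)%N ->
  (forall m x, `|diff2 G (sc m) d e x| <= B) ->
  \sum_(m < M) mean (fun x => diff3 G (sc m) d e x ^+ 2) <= 16 * B ^+ 2.
Proof.
move=> MN td te aB.
have N0 : 0 < N%:R :> R by rewrite ltr0n.
pose S m := mean (fun x => diff2 G (sc m) d e x ^+ 2).
have S0 m : 0 <= S m.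
  rewrite -(gmean_cst x0 h N_gt0 (0 : R)).
  by apply: le_gmean => // x; apply: sqr_ge0.
have SB : S 0%N <= B ^+ 2.
  rewrite -(gmean_cst x0 h N_gt0 (B ^+ 2)); apply: le_gmean => // x.
  rewrite -[leLHS]ger0_norm ?sqr_ge0 // normrX; apply: lerXn2r; rewrite ?nnegrE //.
  exact: le_trans (aB 0%N x).
pose b := 3 * B ^+ 2 / N%:R.
have b0 : 0 <= b by apply: divr_ge0; [apply: mulr_ge0 => //; apply: sqr_ge0|exact: ltW].
have step m : mean (fun x => diff3 G (sc m) d e x ^+ 2) <=
    4 * (S m - S m.+1 + b * 2 ^+ m).
  have := energy_step (aB m); rewrite -/(S m) -/(S m.+1) => h1.
  have : (total d + total e)%:R * B ^+ 2 / N%:R * 2 ^+ m <= b * 2 ^+ m.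
    rewrite /b; apply: ler_wpM2r; first exact: exprn_ge0.
    apply: ler_wpM2r; first by rewrite invr_ge0 ltW.
    by apply: ler_wpM2r; rewrite ?sqr_ge0 // (ler_nat _ _ 3); apply: leq_add td te.
  lra.
have -> : 16 * B ^+ 2 = 4 * (B ^+ 2 + b * N%:R).
  by rewrite /b; field; rewrite gt_eqF.
have : \sum_(m < M) mean (fun x => diff3 G (sc m) d e x ^+ 2) <=
   4 * (S 0%N - S M + b * 2 ^+ M).
  elim: M {MN} => [|M IH]; first by rewrite big_ord0 expr0; lra.
  rewrite big_ord_recr /= exprS; have := step M; lra.
move=> /le_trans; apply; rewrite ler_wpM2l //.
have : b * 2 ^+ M <= b * N%:R by rewrite ler_wpM2l // -natrX ler_nat.
have := S0 M; lra.
Qed.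

(** Moves the estimate from the corner of a block to its node [o]. Squares of third differences are
    at most 4 B^2, so the translation costs 8 B^2 (total o) 2^m / N at scale m, again a geometric
    series. *)
Lemma energy_sum_shift G B d e o M : (2 ^ M <= N)%N ->
  (total d <= 2)%N -> (total e <= 1)%N ->
  (forall m x, `|diff2 G (sc m) d e x| <= B) ->
  \sum_(m < M) mean (fun x => diff3 G (sc m) d e (x + sc m *: natrow R o) ^+ 2)
    <= (16 + 8 * (total o)%:R) * B ^+ 2.
Proof.
move=> MN td te aB.
have N0 : 0 < N%:R :> R by rewrite ltr0n.
have B0 : 0 <= B by apply: le_trans (aB 0%N 0).
pose b := 8 * B ^+ 2 / N%:R * (total o)%:R.
have b0 : 0 <= b.
  apply: mulr_ge0 => //; apply: divr_ge0; last exact: ltW.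
  by apply: mulr_ge0 => //; apply: sqr_ge0.
have step m : mean (fun x => diff3 G (sc m) d e (x + sc m *: natrow R o) ^+ 2) <=
   mean (fun x => diff3 G (sc m) d e x ^+ 2) + b * 2 ^+ m.
  have TB x : `|diff3 G (sc m) d e x ^+ 2| <= 4 * B ^+ 2.
    rewrite normrX (_ : 4 * _ = (2 * B) ^+ 2); last by ring.
    apply: lerXn2r; rewrite ?nnegrE ?mulr_ge0 //.
    by rewrite mulr_natl; apply: le_trans (ler_normB _ _) (lerD _ _).
  have /ler_normlW := shift_le o m TB.
  have -> : 2 * (4 * B ^+ 2) / N%:R * ((total o)%:R * 2 ^+ m) = b * 2 ^+ m.
    by rewrite /b; ring.
  lra.
apply: le_trans (ler_sum _ (fun (m : 'I_M) (_ : true) => step m)) _.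
rewrite big_split /= mulrDl; apply: lerD; first exact: energy_sum.
rewrite -mulr_sumr (_ : 8 * _ * _ = b * N%:R); last first.
  by rewrite /b; field; rewrite gt_eqF.
rewrite ler_wpM2l //; apply: le_trans (_ : 2 ^+ M <= _); last first.
  by rewrite -natrX ler_nat.
elim: M {MN} => [|M IH]; first by rewrite big_ord0 expr0.
rewrite big_ord_recr /= exprS; lra.
Qed.

End Energy.

(** * Small third differences force closeness to a quadratic polynomial *)

Section GridRigidity.
Variables (R : realType) (n : nat).
Implicit Types (u : {ffun 'I_n -> nat}) (x y a b q : 'rV[R]_n) (A : 'M[R]_n).
Implicit Types (f G : 'rV[R]_n -> R).

Definition quad (y l : 'rV[R]_n) A : 'rV[R]_n -> R :=
  fun x => dot l (x - y) + 2^-1 * dot ((x - y) *m A) (x - y).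

Lemma fdiff2_quad y l A a b x : A^T = A ->
  fdiff a (fdiff b (quad y l A)) x = dot (a *m A) b.
Proof.
move=> sA; rewrite /fdiff /quad (_ : x + a + b - y = x - y + a + b); last first.
  by apply/rowP => i; rewrite !mxE; ring.
rewrite [x + a - y]addrAC [x + b - y]addrAC !mulmxDl.
move: (x - y) => z; rewrite !dotE (dot_symm_mx b a sA); lra.
Qed.

Lemma quad_recenter x y l A z : A^T = A ->
  quad y l A (x + z) = quad y l A x + dot (l + (x - y) *m A) z
    + 2^-1 * dot (z *m A) z.
Proof.
move=> sA; rewrite /quad addrAC; move: (x - y) => d.
rewrite mulmxDl !dotE (dot_symm_mx z d sA); lra.
Qed.

Lemma quad_convex_comb x z y l A r : A^T = A ->
  quad y l A ((1 - r) *: x + r *: z) =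
  (1 - r) * quad y l A x + r * quad y l A z
    - 2^-1 * (r * (1 - r) * dot ((x - z) *m A) (x - z)).
Proof.
move=> sA; rewrite /quad.
have -> : (1 - r) *: x + r *: z - y = (1 - r) *: (x - y) + r *: (z - y).
  by apply/rowP => i; rewrite !mxE; ring.
have -> : x - z = (x - y) - (z - y) by rewrite opprB addrA subrK.
move: (x - y) (z - y) => b d.
rewrite mulmxDl mulmxBl -!scalemxAl !dotE (dot_symm_mx d b sA); lra.
Qed.

(* Induction on the number of coordinates that are not integral. *)
Lemma grid_interpolation f y (h c k : R) W :
  (forall u, (forall j, (u j <= W.+1)%N) -> `|f (y + h *: natrow R u)| <= c) ->
  (forall x i r, 0 <= r <= 1 ->
    `|f (x + (r * h) *: delta_mx 0 i)
      - ((1 - r) * f x + r * f (x + h *: delta_mx 0 i))| <= k) ->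
  forall q, (forall i, 0 <= q 0 i <= W%:R) ->
  `|f (y + h *: q)| <= c + n%:R * k.
Proof.
move=> fgrid fseg q qW.
suff H m : (m <= n)%N -> forall q, (forall i : 'I_n, (i < m)%N -> 0 <= q 0 i <= W%:R) ->
    (forall i : 'I_n, (m <= i)%N -> exists2 t : nat, (t <= W.+1)%N & q 0 i = t%:R) ->
    `|f (y + h *: q)| <= c + m%:R * k.
  by apply: H => // i; rewrite leqNgt ltn_ord.
elim: m => [|m IH] mn {}q {}qW qnat.
  have /fin_all_exists[u qu] : forall i, exists t : nat, (t <= W.+1)%N /\ q 0 i = t%:R.
    by move=> i; have [//|t tW ->] := qnat i; exists t.
  rewrite mul0r addr0 (_ : q = natrow R [ffun i => u i]).
    by apply: fgrid => j; rewrite ffunE; case: (qu j).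
  by apply/rowP => i; rewrite !mxE ffunE; case: (qu i).
(* q lies on an edge from t to t + 1 in direction i. For q i = W the far end is W + 1, hence the
   extra layer of nodes in the hypothesis. *)
pose i := Ordinal mn; pose t := Num.truncn (q 0 i).
have /andP[qi0 qiW] := qW i (ltnSn m).
have /andP[tq qt] : t%:R <= q 0 i < t.+1%:R by apply: truncn_itv.
have tW : (t <= W)%N by rewrite -(ler_nat R); apply: le_trans tq qiW.
pose r := q 0 i - t%:R.
have r01 : 0 <= r <= 1 by move: qt; rewrite -natr1 /r => qt; apply/andP; split; lra.
pose q0 := \row_j (if j == i then t%:R else q 0 j) : 'rV[R]_n.
have qE : q = q0 + r *: delta_mx 0 i.
  apply/rowP => j; rewrite !mxE eqxx /=; case: eqP => [->|_] /=.
    by rewrite mulr1 /r addrC subrK.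
  by rewrite mulr0 addr0.
have IHq (p : 'rV[R]_n) (s : nat) : (s <= W.+1)%N -> p 0 i = s%:R ->
    (forall j, j != i -> p 0 j = q 0 j) -> `|f (y + h *: p)| <= c + m%:R * k.
  move=> sW pi pj; apply: IH => [|j jm|j mj]; first exact: ltnW.
  - by rewrite pj; [apply/qW/leqW|rewrite -val_eqE /= ltn_eqF].
  - have [->|ji] := eqVneq j i; first by exists s.
    by rewrite pj //; apply: qnat; rewrite ltn_neqAle mj andbT eq_sym.
have h0 : `|f (y + h *: q0)| <= c + m%:R * k.
  apply: (IHq _ t); rewrite ?mxE ?eqxx //; first exact: leqW.
  by move=> j /negPf ji; rewrite mxE ji.
have h1 : `|f (y + h *: q0 + h *: delta_mx 0 i)| <= c + m%:R * k.
  rewrite -addrA -scalerDr; apply: (IHq _ t.+1); rewrite ?mxE ?eqxx /= ?natr1 //.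
  by move=> j /negPf ji; rewrite !mxE ji eqxx /= addr0.
have := fseg (y + h *: q0) i r r01.
rewrite -[_ + (r * h) *: _]addrA [r * h]mulrC -scalerA -scalerDr -qE.
have -> : c + m.+1%:R * k = c + m%:R * k + k by rewrite -natr1; ring.
move: r01 => /andP[r0 r1]; move: h0 h1; rewrite !ler_norml.
set C := c + m%:R * k; set F0 := f _; set F1 := f (_ + _ + _).
move=> /andP[? ?] /andP[? ?] /andP[? ?]; apply/andP; split; nra.
Qed.

(** A discrete Taylor formula: [A] and [l] are fitted so that the second and first differences of
    the remainder vanish at y. Summing along lattice paths three times, each at the price of n (W +
    1), bounds the remainder at the nodes; between nodes the C^{1,1} bound interpolates. *)
Lemma near_quad_of_diff3_small G L y h c W : 0 < h -> 0 <= c -> C11_bound L G ->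
  (forall u i j k, (forall j, (u j <= W.+1)%N) ->
    `|fdiff (h *: delta_mx 0 k) (fdiff (h *: delta_mx 0 i)
       (fdiff (h *: delta_mx 0 j) G)) (y + h *: natrow R u)| <= c) ->
  exists A l, A^T = A /\ forall q, (forall i, 0 <= q 0 i <= W%:R) ->
    `|G (y + h *: q) - G y - quad y l A (y + h *: q)| <=
      (n * W.+1)%:R ^+ 3 * c + n%:R * (L * h ^+ 2).
Proof.
move=> h0 c0 GL small.
pose e i : 'rV[R]_n := delta_mx 0 i.
pose A := \matrix_(i, j) (fdiff (h *: e i) (fdiff (h *: e j) G) y / h ^+ 2).
have sA : A^T = A by apply/matrixP => i j; rewrite !mxE fdiffC.
pose E1 x := G x - quad y 0 A x.
pose l := \row_j (fdiff (h *: e j) E1 y / h).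
pose E2 x := G x - G y - quad y l A x.
have E2E x : E2 x = E1 x - G y - dot l (x - y).
  by rewrite /E2 /E1 /quad dot0l; ring.
pose K := (n * W.+1)%:R : R.
have K0 : 0 <= K by rewrite ler0n.
have hn0 : h != 0 by rewrite gt_eqF.
have D1 u i j : (forall j, (u j <= W.+1)%N) ->
    `|fdiff (h *: e i) (fdiff (h *: e j) E1) (y + h *: natrow R u)| <= K * c.
  move=> uW.
  have -> : fdiff (h *: e i) (fdiff (h *: e j) E1) (y + h *: natrow R u) =
      fdiff (h *: e i) (fdiff (h *: e j) G) (y + h *: natrow R u)
      - fdiff (h *: e i) (fdiff (h *: e j) G) y.
    transitivity (fdiff (h *: e i) (fdiff (h *: e j) G) (y + h *: natrow R u)
      - fdiff (h *: e i) (fdiff (h *: e j) (quad y 0 A)) (y + h *: natrow R u)).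
      by rewrite /fdiff /E1; ring.
    rewrite fdiff2_quad // -scalemxAl !dotE dot_delta_mx mxE; congr (_ - _).
    by rewrite mulrA -expr2 mulrC divfK // expf_neq0.
  apply: (@grid_path _ _ (fdiff (h *: e i) (fdiff (h *: e j) G)) _ _ _ W.+1) => // v k vW.
  apply: small => r; apply: leq_trans (vW r); by rewrite addvE leq_addr.
have D2 u j : (forall j, (u j <= W.+1)%N) ->
    `|fdiff (h *: e j) E2 (y + h *: natrow R u)| <= K * (K * c).
  move=> uW.
  have -> : fdiff (h *: e j) E2 (y + h *: natrow R u) =
      fdiff (h *: e j) E1 (y + h *: natrow R u) - fdiff (h *: e j) E1 y.
    transitivity (fdiff (h *: e j) E1 (y + h *: natrow R u) - dot l (h *: e j)).
      rewrite /fdiff !E2E (_ : y + h *: natrow R u + h *: e j - y =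
        (y + h *: natrow R u - y) + h *: e j) ?dotE; first by ring.
      by rewrite addrAC.
    by rewrite !dotE dot_deltar mxE mulrCA divff // mulr1.
  apply: (@grid_path _ _ (fdiff (h *: e j) E1) _ _ _ W.+1) => // [|v k vW].
    exact: mulr_ge0.
  apply: D1 => r; apply: leq_trans (vW r); by rewrite addvE leq_addr.
have E2y : E2 y = 0 by rewrite /E2 /quad !subrr dot0r mul0mx dot0l mulr0 addr0 subr0.
have D3 u : (forall j, (u j <= W.+1)%N) -> `|E2 (y + h *: natrow R u)| <= K ^+ 3 * c.
  move=> uW; rewrite -[E2 _]subr0 -E2y.
  rewrite (_ : K ^+ 3 * c = K * (K * (K * c))); last by ring.
  apply: (@grid_path _ _ E2 _ _ _ W.+1) => // [|v k vW].
    by rewrite !mulr_ge0.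
  apply: D2 => r; apply: leq_trans (vW r); by rewrite addvE leq_addr.
exists A, l; split=> //; apply: grid_interpolation D3 _ => x i r r01.
(* Along an edge G and the quadratic each deviate from linear interpolation by at most r (1 - r) L
   h^2, together at most L h^2 / 2. *)
have Aii : `|A i i| <= 2 * L.
  rewrite mxE normrM [`|_^-1|]ger0_norm ?invr_ge0 ?sqr_ge0 //.
  rewrite ler_pdivrMr ?exprn_gt0 //.
  apply: le_trans (fdiff2_bound _ _ _ GL) _.
  by rewrite !dotE dot_deltar !mxE !eqxx /=; lra.
have xE : x + (r * h) *: delta_mx 0 i = (1 - r) *: x + r *: (x + h *: delta_mx 0 i).
  by apply/rowP => j; rewrite !mxE; ring.
have := GL r x (x + h *: delta_mx 0 i) r01.
rewrite /E2 xE quad_convex_comb //.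
rewrite (_ : x - (x + _) = - (h *: delta_mx 0 i)); last first.
  by rewrite opprD addrA subrr add0r.
rewrite mulNmx -scalemxAl !dotE dot_delta_mx dot_deltar mxE !eqxx /= mulr1.
rewrite !opprK.
move: r01 Aii => /andP[r0 r1]; rewrite !ler_norml => /andP[a1 a2] /andP[g1 g2].
have w0 : 0 <= r * (1 - r) by rewrite mulr_ge0 ?subr_ge0.
have w4 : r * (1 - r) <= 4^-1 by have := sqr_ge0 (r - 2^-1); lra.
have wh0 : 0 <= r * (1 - r) * (h * h) by rewrite mulr_ge0 // mulr_ge0 // ltW.
have p1 := ler_wpM2l wh0 a1; have p2 := ler_wpM2l wh0 a2.
have L0 : 0 <= L * (h * h) by rewrite mulr_ge0 ?mulr_ge0 ?(ltW h0) //; lra.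
have p3 := ler_wpM2r L0 w4.
apply/andP; split; lra.
Qed.

(** The approximation is used at x and at x + z, which doubles the error; recentering changes the
    slope but not the Hessian. *)
Lemma near_quad_ball G y h c W A l : A^T = A ->
  (forall q, (forall i, 0 <= q 0 i <= W%:R) ->
    `|G (y + h *: q) - G y - quad y l A (y + h *: q)| <= c) ->
  forall x rho, 0 < h -> (forall i, y 0 i + rho <= x 0 i) ->
    (forall i, x 0 i + rho <= y 0 i + h * W%:R) ->
  exists l', forall z : 'rV[R]_n, (forall i, `|z 0 i| <= rho) ->
    `|G (x + z) - G x - dot l' z - 2^-1 * dot (z *m A) z| <= 2 * c.
Proof.
move=> sA yG x rho h0 xlo xhi; exists (l + (x - y) *m A) => z zr.
have near (z' : 'rV[R]_n) : (forall i, `|z' 0 i| <= rho) ->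
    `|G (x + z') - G y - quad y l A (x + z')| <= c.
  move=> z'r; rewrite (_ : x + z' = y + h *: (h^-1 *: (x + z' - y))); last first.
    by rewrite scalerA divff ?scale1r ?gt_eqF // addrCA subrr addr0.
  apply: yG => i; rewrite !mxE; have := z'r i; rewrite ler_norml => /andP[z1 z2].
  have := xlo i; have := xhi i => x1 x2.
  rewrite mulrC ler_pdivlMr // mul0r ler_pdivrMr // mulrC.
  by apply/andP; split; lra.
have z0 i : `|(0 : 'rV[R]_n) 0 i| <= rho.
  by rewrite mxE normr0; apply: le_trans (zr i).
have := near z zr; have := near 0 z0; rewrite addr0 quad_recenter // !ler_norml.
by move=> /andP[? ?] /andP[? ?]; apply/andP; split; lra.
Qed.

End GridRigidity.

(** * Polarization and the total defect over all scales *)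

Section Pigeonhole.
Variables (R : realType) (n : nat).
Implicit Types (u d e : {ffun 'I_n -> nat}) (x y a b : 'rV[R]_n).
Implicit Types (f G : 'rV[R]_n -> R).

(** [diff3] takes one direction twice, so mixed directions must be recovered; the base points are
    chosen to make the polarization identity exact for differences. *)
Lemma fdiff_polarization a b f x :
  2 * fdiff b (fdiff a f) (x + a) = fdiff (a + b) (fdiff (a + b) f) x
    - fdiff a (fdiff a f) x - fdiff b (fdiff b f) (x + a + a).
Proof.
rewrite /fdiff !addrA ![x + a + b + a]addrAC.
by ring.
Qed.

(* The directions e_i and e_i + e_k suffice to recover all mixed third
   differences by polarization. *)
Definition dir_index : finType := ('I_n * 'I_n * bool * 'I_n)%type.

(** In [diff3 G t (dir2 p) (dir1 p)] this direction is taken twice and [dir1 p] once. *)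
Definition dir2 (p : dir_index) : {ffun 'I_n -> nat} :=
  unitv p.1.1.1 + (if p.1.2 then unitv p.1.1.2 else 0).

Definition dir1 (p : dir_index) : {ffun 'I_n -> nat} := unitv p.2.

Lemma total_dir2 p : (total (dir2 p) <= 2)%N.
Proof.
rewrite totalD total_unitv; case: ifP => _; first by rewrite total_unitv.
by rewrite /total big1 // => i _; rewrite ffunE.
Qed.

Lemma total_dir1 p : (total (dir1 p) <= 1)%N.
Proof. by rewrite total_unitv. Qed.

Lemma diff2_dir_bound L G h p x : 0 <= L -> 0 < h -> C11_bound L G ->
  `|diff2 G h (dir2 p) (dir1 p) x| <= 5 * L.
Proof.
move=> L0 h0 /(diff2_bound (dir2 p) (dir1 p) x h0) /le_trans; apply.
rewrite mulrC ler_wpM2r // /dir1 natrow_unitv dot_deltar mxE !eqxx /=.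
suff : dot (natrow R (dir2 p)) (natrow R (dir2 p)) <= 4 by lra.
rewrite /dir2 natrowD natrow_unitv !dotE !dot_deltar.
case: ifP => _; last by rewrite natrow0 !dotE !mxE !eqxx /=; lra.
rewrite natrow_unitv !dot_deltar !mxE !eqxx /=.
by do 2![case: eqP => _] => /=; lra.
Qed.

Definition offset W (o : {ffun 'I_n -> 'I_W}) : {ffun 'I_n -> nat} :=
  [ffun i => o i : nat].

(** A single nonnegative quantity that dominates each squared third difference on a block of nodes
    and can be averaged over x. *)
Definition defect G t W x : R :=
  \sum_(o : {ffun 'I_n -> 'I_W}) \sum_(p : dir_index)
    diff3 G t (dir2 p) (dir1 p) (x + t *: natrow R (offset o)) ^+ 2.

Lemma diff3_small_of_defect G t W x c : 0 < t -> 0 <= c ->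
  defect G t W x <= c ^+ 2 ->
  forall u p, (forall i, (u i < W)%N) ->
  `|diff3 G t (dir2 p) (dir1 p) (x + t *: natrow R u)| <= c.
Proof.
move=> t0 c0 dc u p uW; pose o : {ffun 'I_n -> 'I_W} := [ffun i => Ordinal (uW i)].
have -> : u = offset o by apply/ffunP => i; rewrite !ffunE.
rewrite -(ler_pXn2r (ltn0Sn 1)) ?nnegrE // -normrX ger0_norm ?sqr_ge0 //.
apply: le_trans dc; rewrite /defect (bigD1 o) //= (bigD1 p) //=.
rewrite -addrA lerDl addr_ge0 //; first by apply: sumr_ge0 => q _; apply: sqr_ge0.
by apply: sumr_ge0 => q _; apply: sumr_ge0 => q' _; apply: sqr_ge0.
Qed.

(** Polarizing at u + 1 uses the nodes u + 1 - e_i and u + 1 + e_i: the shift by [const_mx 1] keeps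
    the first in the block, and side W + 3 makes room for the second. *)
Lemma fdiff3_small_of_defect G t W x c : 0 < t -> 0 <= c ->
  defect G t W.+3 x <= c ^+ 2 ->
  forall u i j k, (forall j, (u j <= W)%N) ->
  `|fdiff (t *: delta_mx 0 k) (fdiff (t *: delta_mx 0 i)
      (fdiff (t *: delta_mx 0 j) G)) (x + t *: const_mx 1 + t *: natrow R u)|
    <= 2 * c * t ^+ 2.
Proof.
move=> t0 c0 /(diff3_small_of_defect t0 c0) dc u i j k uW.
pose v : {ffun 'I_n -> nat} := [ffun r => (u r + (r != i))%N].
have vW r : (v r < W.+3)%N by rewrite ffunE; case: (r != i); have := uW r; lia.
have vW2 r : ((v + unitv i + unitv i)%R r < W.+3)%N.
  by rewrite !addvE !ffunE; case: (r == i); have := uW r; lia.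
have -> : x + t *: const_mx 1 + t *: natrow R u
    = x + t *: natrow R v + t *: delta_mx 0 i.
  rewrite -!addrA -!scalerDr -natrow_unitv -natrowD; congr (_ + _ *: _).
  by apply/rowP => r; rewrite !mxE addvE !ffunE !natrD; case: eqP => _ /=; ring.
have t20 : 0 < t ^+ 2 by apply: exprn_gt0.
pose y := x + t *: natrow R v.
have yi : y + t *: delta_mx 0 i + t *: delta_mx 0 i =
    x + t *: natrow R (v + unitv i + unitv i).
  by rewrite -!addrA -!scalerDr -!natrow_unitv -!natrowD addrA.
have unscale p z : `|diff3 G t (dir2 p) (dir1 p) z| <= c ->
    `|fdiff (t *: natrow R (dir2 p)) (fdiff (t *: natrow R (dir2 p))
      (fdiff (t *: natrow R (dir1 p)) G)) z| <= c * t ^+ 2.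
  have -> : diff3 G t (dir2 p) (dir1 p) z =
      fdiff (t *: natrow R (dir2 p)) (fdiff (t *: natrow R (dir2 p))
        (fdiff (t *: natrow R (dir1 p)) G)) z / t ^+ 2.
    by rewrite /diff3 /diff2 [in LHS]/fdiff -mulrBl.
  by rewrite normrM [`|_^-1|]gtr0_norm ?invr_gt0 // ler_pdivrMr.
have := unscale _ _ (dc _ (i, k, true, j) vW).
have := unscale _ _ (dc _ (i, i, false, j) vW).
have := unscale _ _ (dc _ (k, k, false, j) vW2).
rewrite -yi -/y /dir2 /dir1 /= !addr0 natrowD !natrow_unitv [t *: (_ + _)]scalerDr.
set f := fdiff (t *: delta_mx 0 j) G.
have := fdiff_polarization (t *: delta_mx 0 i) (t *: delta_mx 0 k) f y.
rewrite -[y + _ + _]/(y + t *: 'e_i + t *: 'e_i) !ler_norml.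
set F := fdiff _ _ (y + _); set F1 := fdiff (_ + _) _ _; set F2 := fdiff _ _ y.
set F3 := fdiff _ _ _.
by move=> E /andP[? ?] /andP[? ?] /andP[? ?]; apply/andP; split; lra.
Qed.

Lemma sum_mean_defect_le G L N M (x0 : 'rV[R]_n) h W : 0 <= L -> 0 < h ->
  (0 < N)%N -> (2 ^ M <= N)%N -> C11_bound L G ->
  \sum_(m < M) gmean N x0 h (defect G (2 ^+ m * h) W) <=
    (#|{ffun 'I_n -> 'I_W}| * #|dir_index|)%:R *
      ((16 + 8 * (n * W)%:R) * (5 * L) ^+ 2).
Proof.
move=> L0 h0 N0 MN GL; rewrite /defect.
under eq_bigr do rewrite gmean_sum.
under eq_bigr do under eq_bigr do rewrite gmean_sum.
rewrite exchange_big natrM -mulrA mulr_natl -sumr_const; apply: ler_sum => o _.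
rewrite exchange_big mulr_natl -sumr_const; apply: ler_sum => p _.
apply: le_trans (@energy_sum_shift _ _ _ x0 h N0 G (5 * L) _ _ _ _ MN
  (total_dir2 p) (total_dir1 p) _) _.
  by move=> m x; apply: diff2_dir_bound; rewrite // mulr_gt0 ?exprn_gt0.
apply: ler_wpM2r; first exact: sqr_ge0.
rewrite lerD2l ler_wpM2l // ler_nat; apply: total_le => i.
by rewrite ffunE ltnW.
Qed.

End Pigeonhole.

(** * Approximate second order differentiability at separated points *)

Section Counting.
Variables (R : realType) (n : nat).
Implicit Types (x y a b : 'rV[R]_n) (f G : 'rV[R]_n -> R).

(** Group the (K r)^n nodes into K^n cells of r^n nodes. If f > t at all nodes of the P^n distinct
    cells [c k], the mean is at least (P / K)^n t. *)
Lemma grid_counting f P K r (c : {ffun 'I_n -> 'I_P} -> {ffun 'I_n -> 'I_K})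
    (x0 : 'rV[R]_n) h t :
  (forall x, 0 <= f x) -> 0 <= t -> injective c -> (0 < K)%N -> (0 < r)%N ->
  gmean (K * r) x0 h f < (P%:R / K%:R) ^+ n * t ->
  exists k, exists s : {ffun 'I_n -> 'I_r},
    f (x0 + h *: natrow R [ffun i => (c k i * r + s i)%N]) <= t.
Proof.
move=> f0 t0 c_inj K0 r0 flt; apply: contrapT => nogood.
have bad k (s : {ffun 'I_n -> 'I_r}) : t < f (x0 + h *: natrow R [ffun i => (c k i * r + s i)%N]).
  by rewrite ltNge; apply/negP => ft; apply: nogood; exists k, s.
have fine_lt (a : 'I_K) (b : 'I_r) : (a * r + b < K * r)%N.
  apply: (@leq_trans (a.+1 * r)); first by rewrite mulSn addnC ltn_add2r.
  by rewrite leq_mul2r ltn_ord orbT.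
pose F (q : {ffun 'I_n -> 'I_P} * {ffun 'I_n -> 'I_r}) : {ffun 'I_n -> 'I_(K * r)} :=
  [ffun i => Ordinal (fine_lt (c q.1 i) (q.2 i))].
have F_inj : injective F.
  move=> [k s] [k' s'] /ffunP e.
  have e' i : (c k i = c k' i) /\ s i = s' i.
    have := congr1 (@nat_of_ord _) (e i); rewrite !ffunE /= => ei.
    split; apply: val_inj => /=.
      have := congr1 (divn ^~ r) ei.
      by rewrite !divnMDl // !divn_small // !addn0.
    by have := congr1 (modn ^~ r) ei; rewrite !modnMDl !modn_small.
  congr pair; last by apply/ffunP => i; case: (e' i).
  by apply: c_inj; apply/ffunP => i; case: (e' i).
have KR0 : 0 < (K * r)%:R ^+ n :> R by rewrite exprn_gt0 // ltr0n muln_gt0 K0.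
move: flt; apply/negP; rewrite -leNgt /gmean ler_pdivlMl //.
apply: le_trans (_ : (P ^ n * r ^ n)%:R * t <= _).
  rewrite !natrM !natrX exprMn mulrA ler_wpM2r //.
  have K0' : (K%:R : R) != 0 by rewrite pnatr_eq0 -lt0n.
  by rewrite mulrAC -exprMn mulrCA divff // mulr1.
apply: le_trans (_ : \sum_(z in [set F q | q in [set: _]%SET]%SET) t <= _).
  rewrite sumr_const card_imset // cardsT card_prod !card_ffun !card_ord.
  by rewrite mulr_natl.
rewrite [leRHS](bigID (mem [set F q | q in [set: _]%SET]%SET)) /=.
rewrite -[leLHS]addr0; apply: lerD; last by apply: sumr_ge0.
apply: ler_sum => z /imsetP[[k s] _ ->]; apply: le_trans (ltW (bad k s)) _.
rewrite /gridpt le_eqVlt; apply/orP; left; apply/eqP.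
by congr (f (_ + _ *: natrow _ _)); apply/ffunP => i; rewrite !ffunE.
Qed.

End Counting.

Section Main.
Variables (R : realType) (n : nat).
Implicit Types (x y a b p q z : 'rV[R]_n) (G : 'rV[R]_n -> R).

(* A quantitative substitute for the theorems of Alexandrov and Jensen. The
   points xi p of distinct p in a grid of mesh r / Q lie in distinct cells of
   side t ~ r / (Q g), hence occupy a fixed proportion kap^-n of all cells, at
   every scale t. The total defect over M dyadic scales is bounded
   independently of M, so at some scale the cells with large third differences
   cannot contain all of the xi p. *)
Lemma C11_near_quad G (L : R) (xi : 'rV[R]_n -> 'rV[R]_n) (r g B d s0 : R) :
  0 <= L -> C11_bound L G -> 0 < r -> 0 < g -> 0 < d -> 0 < s0 ->
  let box p := forall i, 0 <= p 0 i <= r in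
  (forall p i, box p -> `|xi p 0 i| <= B) ->
  (forall p q s, box p -> box q -> (forall i, `|xi p 0 i - xi q 0 i| <= s) ->
    forall i, `|p 0 i - q 0 i| <= g * s) ->
  exists p rho A l, [/\ box p, 0 < rho <= s0, A^T = A &
    forall z, (forall i, `|z 0 i| <= rho) ->
      `|G (xi p + z) - G (xi p) - dot l z - 2^-1 * dot (z *m A) z|
        <= d * rho ^+ 2].
Proof.
move=> L0 GL r0 g0 d0 s00 box xiB sep.
have archi (y : R) : exists k : nat, (0 < k)%N /\ y < k%:R.
  exists (Num.bound `|y|).+1; split=> //.
  apply: le_lt_trans (ler_norm y) _; apply: lt_le_trans (archi_boundP (normr_ge0 y)) _.
  by rewrite ler_nat.
(* The radius will be b t. Interpolation contributes 2 n L t^2, at most half of d (b t)^2 once n L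
   <= d b / 4. *)
have [b [b0 bL]] := archi (4 * (n%:R * L) / d).
(* Room for the cube of radius b t about a point located only up to two steps. *)
pose W := (2 * b + 2)%N; pose K3 : R := (n * W.+1)%:R ^+ 3.
have K30 : 0 <= K3 by rewrite exprn_ge0.
(* Third differences up to e contribute 4 K3 e t^2 <= d t^2 / 2 to the final error. *)
pose e : R := d / (8 * (K3 + 1)).
have e0 : 0 < e by rewrite divr_gt0 // mulr_gt0 // ltr_wpDl.
pose B1 : R := `|B| + 1; have B10 : 0 < B1 by rewrite ltr_wpDl.
(* Side of the cube [-2 B1, 2 B1]^n, which leaves a margin B1 around the contact points. *)
pose ell : R := 4 * B1; have ell0 : 0 < ell by rewrite mulr_gt0.
(* There will be kap Q cells of side t = ell / (kap Q) per axis and Q values of p; this kap gives g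
   t < r / Q, so distinct p get distinct cells. *)
have [kap [kap0 kapE]] := archi (ell * g / r).
(* All scales satisfy t <= ell / K1, which ensures t b <= s0 and t (b + 2) <= B1. *)
have [K1 [K10 K1E]] := archi (4 * B1 * b%:R / s0 + 4 * (b + 2)%:R).
pose K0 := (kap * K1)%N.
have K00 : (0 < K0)%N by rewrite muln_gt0 kap0.
pose tot : R := (#|{ffun 'I_n -> 'I_W.+4}| * #|dir_index n|)%:R *
      ((16 + 8 * (n * W.+4)%:R) * (5 * L) ^+ 2).
have kapn0 : 0 < (kap%:R ^- n) * e ^+ 2 :> R.
  by rewrite mulr_gt0 ?exprn_gt0 // invr_gt0 exprn_gt0 // ltr0n.
have [M [M0 ME]] := archi (tot / (kap%:R ^- n * e ^+ 2)).
pose N := (K0 * 2 ^ M)%N.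
have N0 : (0 < N)%N by rewrite muln_gt0 K00 expn_gt0.
pose h : R := ell / N%:R; have h0 : 0 < h by rewrite divr_gt0 // ltr0n.
pose x0 : 'rV[R]_n := const_mx (- (2 * B1)).
(* Some scale has mean defect below the total divided by M. Of the four extra layers in [W.+4],
   three serve polarization and one interpolation. *)
have [m mdef] : exists m : 'I_M,
    gmean N x0 h (defect G (2 ^+ m * h) W.+4) < kap%:R ^- n * e ^+ 2.
  apply: contrapT => nom.
  have := @sum_mean_defect_le R n G L N M x0 h W.+4 L0 h0 N0 _ GL.
  rewrite leq_pmull // => /(_ isT); apply/negP; rewrite -ltNge -/tot.
  move: ME; rewrite ltr_pdivrMr // => /lt_le_trans; apply.
  rewrite mulr_natl -[M in X in X <= _]card_ord -sumr_const; apply: ler_sum => m _.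
  by rewrite leNgt; apply/negP => mlt; apply: nom; exists m.
pose t : R := 2 ^+ m * h; have t0 : 0 < t by rewrite mulr_gt0 ?exprn_gt0.
have t0' := ltW t0; have e0' := ltW e0; have r0' := ltW r0.
pose Q := (K1 * 2 ^ (M - m))%N.
have Q0 : (0 < Q)%N by rewrite muln_gt0 K10 expn_gt0.
have mM : (m <= M)%N by apply: ltnW.
have NE : N = (kap * Q * 2 ^ m)%N.
  by rewrite /N /K0 /Q -!mulnA -expnD subnK.
have tE : t * (kap * Q)%:R = ell.
  rewrite /t /h NE [in X in _ / X]natrM natrX; field.
  by rewrite expf_neq0 //= !pnatr_eq0 -!lt0n Q0.
have tK0 : t * K0%:R <= ell.
  rewrite -tE ler_wpM2l // ler_nat /K0 /Q mulnA leq_pmulr //.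
  by rewrite expn_gt0.
have K0K1 : (K1%:R : R) <= K0%:R by rewrite ler_nat leq_pmull.
have tK1 : t * K1%:R <= ell by apply: le_trans tK0; rewrite ler_wpM2l.
have tb : t * (b + 2)%:R <= B1.
  have : t * (4 * (b + 2)%:R) <= ell.
    apply: le_trans tK1; rewrite ler_wpM2l //; apply/ltW/(le_lt_trans _ K1E).
    by rewrite lerDr divr_ge0 ?(ltW s00) // mulr_ge0 // mulr_ge0 // ltW.
  by rewrite /ell; clear; lra.
have rho_s0 : t * b%:R <= s0.
  have : t * (4 * B1 * b%:R / s0) <= ell.
    apply: le_trans tK1; rewrite ler_wpM2l //; apply/ltW/(le_lt_trans _ K1E).
    by rewrite lerDl mulr_ge0.
  rewrite mulrA ler_pdivrMr // => tbs.
  by rewrite -(ler_pM2l ell0); apply: le_trans tbs; rewrite /ell; clear; lra.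
pose pp (k : {ffun 'I_n -> 'I_Q}) : 'rV[R]_n := \row_i (r / Q%:R * (k i)%:R).
have Q0' : 0 < Q%:R :> R by rewrite ltr0n.
have boxpp k : box (pp k).
  move=> i; rewrite mxE mulr_ge0 ?divr_ge0 ?(ltW Q0') //=.
  by rewrite mulrAC ler_pdivrMr // ler_wpM2l // ler_nat ltnW.
(* Cells are located b + 2 steps before the contact point, so that a block based at any node of the
   cell contains the whole ball. *)
pose pos k i := (xi (pp k) 0 i - t * (b + 2)%:R + 2 * B1) / t.
have BB1 : B <= B1 by apply: le_trans (ler_norm _) _; rewrite lerDl.
have pos_itv k i : 0 <= pos k i < (kap * Q)%:R.
  have := xiB _ i (boxpp k); rewrite ler_norml => /andP[x1 x2].
  rewrite /pos ler_pdivlMr // mul0r ltr_pdivrMr // [_%:R * t]mulrC tE /ell.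
  have p0 : 0 <= t * (b + 2)%:R by rewrite mulr_ge0.
  by clear - x1 x2 p0 BB1 tb B10; apply/andP; split; lra.
have cell_lt k i : (Num.truncn (pos k i) < kap * Q)%N.
  case/andP: (pos_itv k i) => p0 pK.
  by rewrite -(ltr_nat R); apply: le_lt_trans pK; case/andP: (truncn_itv p0).
pose c k : {ffun 'I_n -> 'I_(kap * Q)} := [ffun i => Ordinal (cell_lt k i)].
have gtr : g * t < r / Q%:R.
  rewrite ltr_pdivlMr //; move: kapE; rewrite ltr_pdivrMr // -tE natrM => kE.
  have kap0' : 0 < kap%:R :> R by rewrite ltr0n.
  by rewrite -(ltr_pM2l kap0'); clear - kE; lra.
have c_inj : injective c.
  move=> k k' /ffunP ckk'.
  have close i : `|xi (pp k) 0 i - xi (pp k') 0 i| <= t.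
    have := congr1 (@nat_of_ord _) (ckk' i); rewrite !ffunE /= => ck.
    case/andP: (pos_itv k i) => /truncn_itv /andP[a1 a2] _.
    case/andP: (pos_itv k' i) => /truncn_itv /andP[].
    rewrite -ck => a3 a4 _; move: a1 a2 a3 a4; rewrite /pos.
    rewrite !ler_pdivlMr // !ltr_pdivrMr // -natr1 => a1 a2 a3 a4.
    by clear - a1 a2 a3 a4; rewrite ler_norml; apply/andP; split; lra.
  apply/ffunP => i; apply: val_inj => /=.
  have := sep _ _ _ (boxpp k) (boxpp k') close i.
  rewrite !mxE -mulrBr normrM gtr0_norm ?divr_gt0 // => /le_lt_trans/(_ gtr).
  rewrite gtr_pMr ?divr_gt0 // ltr_norml => /andP[k1 k2].
  apply/eqP; rewrite eqn_leq; apply/andP; split;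
    by rewrite -ltnS -(ltr_nat R) -addn1 natrD; clear - k1 k2; lra.
have kQ0 : (0 < kap * Q)%N by rewrite muln_gt0 kap0.
have def0 x : 0 <= defect G t W.+4 x.
  by apply: sumr_ge0 => o _; apply: sumr_ge0 => q _; apply: sqr_ge0.
have [k [s dks]] : exists k, exists s : {ffun 'I_n -> 'I_(2 ^ m)},
    defect G t W.+4 (x0 + h *: natrow R [ffun i => (c k i * 2 ^ m + s i)%N])
      <= e ^+ 2.
  apply: (grid_counting def0 _ c_inj kQ0); rewrite ?sqr_ge0 ?expn_gt0 //.
  rewrite -NE; apply: lt_le_trans mdef _; rewrite ler_wpM2r ?sqr_ge0 //.
  rewrite natrM invfM mulrCA divff ?gt_eqF // mulr1 exprVn.
  exact: lexx.
pose y := x0 + h *: natrow R [ffun i => (c k i * 2 ^ m + s i)%N] + t *: const_mx 1.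
have et0 : 0 <= 2 * e * t ^+ 2 by rewrite mulr_ge0 ?sqr_ge0 // mulr_ge0.
have [A [l [sA Al]]] := near_quad_of_diff3_small t0 et0 GL
  (fdiff3_small_of_defect t0 (ltW e0) dks).
(* The two steps of uncertainty come from the truncation of [pos] and from the position of the node
   [s] inside its cell. *)
have y_itv i : y 0 i + t * b%:R <= xi (pp k) 0 i <= y 0 i + t * (b + 2)%:R.
  have [f f01 ->] : exists2 f : R, 0 <= f <= t &
      y 0 i = - (2 * B1) + t * (Num.truncn (pos k i))%:R + f + t.
    exists (h * (s i)%:R).
      rewrite mulr_ge0 ?(ltW h0) //= /t mulrC ler_wpM2r ?(ltW h0) //.
      by rewrite -natrX ler_nat ltnW.
    by rewrite !mxE !ffunE /= natrD natrM natrX /t; clear; ring.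
  case/andP: (pos_itv k i) => /truncn_itv /andP[].
  rewrite {2 3}/pos; set T := Num.truncn _.
  have TS : T.+1%:R = T%:R + 1 :> R by rewrite natr1.
  rewrite ler_pdivlMr // ltr_pdivrMr // TS ![(b + 2)%:R]natrD.
  move: f01 => /andP[f0 f1] p1 p2 _.
  by clear - f0 f1 p1 p2; apply/andP; split; lra.
have [||l' Al'] := near_quad_ball sA Al (x := xi (pp k)) (rho := t * b%:R) t0.
- by move=> i; case/andP: (y_itv i).
- move=> i; case/andP: (y_itv i) => _ yi; apply: le_trans (lerD yi (lexx _)) _.
  have -> : W%:R = 2 * b%:R + 2 :> R by rewrite /W -natrM -natrD.
  by rewrite [(b + 2)%:R]natrD; clear; lra.
exists (pp k), (t * b%:R), A, l'; split=> //.
  by rewrite rho_s0 andbT mulr_gt0 ?ltr0n.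
move=> z zb; apply: le_trans (Al' z zb) _.
have b1 : 1 <= b%:R :> R by rewrite ler1n.
have K3e : K3 * e <= d / 8.
  rewrite /e mulrA ler_pdivrMr ?mulr_gt0 ?ltr_wpDl //.
  by clear - d0; lra.
have nL : n%:R * L <= d * b%:R / 4.
  by move: bL; rewrite ltr_pdivrMr // => /ltW; clear; lra.
have t2 : 0 <= t ^+ 2 by apply: sqr_ge0.
rewrite -/K3; apply: le_trans (_ : d * (1 + b%:R) / 2 * t ^+ 2 <= _).
  rewrite [leLHS](_ : _ = (4 * (K3 * e) + 2 * (n%:R * L)) * t ^+ 2); last by ring.
  by rewrite ler_wpM2r //; clear - K3e nL; lra.
rewrite [leRHS](_ : _ = d * b%:R ^+ 2 * t ^+ 2); last by ring.
rewrite ler_wpM2r // -mulrA ler_wpM2l ?(ltW d0) //.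
by clear - b1; nra.
Qed.

End Main.

(** * Upper semicontinuous functions *)

Section Usc.
Variables (R : realType).
Local Open Scope ereal_scope.

(** The condition of [usc_on] over any topological space, so that it also applies to functions on K
    x K. *)
Definition usc_within (T : topologicalType) (K : set T) (f : T -> \bar R) : Prop :=
  (forall x, K x -> f x != +oo) /\
  forall x, K x -> forall t : R, f x < t%:E -> \forall y \near x, K y -> f y < t%:E.

Lemma lte_add_split (a b : \bar R) (t : R) : a != +oo -> b != +oo ->
  a + b < t%:E -> exists r s : R, [/\ a < r%:E, b < s%:E & (r + s <= t)%R].
Proof.
case: a b => [a| |] [b| |] //= _ _.
- rewrite -EFinD !lte_fin => abt; exists (a + (t - (a + b)) / 2)%R, (b + (t - (a + b)) / 2)%R.
  by rewrite !lte_fin; split; lra.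
- by move=> _; exists (a + 1)%R, (t - a - 1)%R; rewrite lte_fin ltNyr; split => //; lra.
- by move=> _; exists (t - b - 1)%R, (b + 1)%R; rewrite lte_fin ltNyr; split => //; lra.
- by move=> _; exists t, 0%R; rewrite !ltNyr; split => //; lra.
Qed.

Lemma adde_neqy (a b : \bar R) : a != +oo -> b != +oo -> a + b != +oo.
Proof. by case: a b => [a| |] [b| |]. Qed.

Lemma usc_within_add (T : topologicalType) (K : set T) (f g : T -> \bar R) :
  usc_within K f -> usc_within K g -> usc_within K (fun x => f x + g x).
Proof.
move=> [fy fK] [gy gK]; split=> [x Kx|x Kx t]; first by rewrite adde_neqy ?fy ?gy.
move=> /(lte_add_split (fy _ Kx) (gy _ Kx))[r [s [fr gs rst]]].
apply: filterS2 (fK x Kx r fr) (gK x Kx s gs) => y fyr gys Ky.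
apply: lt_le_trans (_ : (r + s)%:E <= _); last by rewrite lee_fin.
by rewrite EFinD; apply: lteD; [exact: fyr|exact: gys].
Qed.

Lemma usc_within_continuous (T : topologicalType) (K : set T) (q : T -> R) :
  continuous q -> usc_within K (fun x => (q x)%:E).
Proof.
move=> qc; split=> // x Kx t; rewrite lte_fin => qt.
have : \forall y \near x, (q y < t)%R by apply: (cvgr_lt (q x)) => //; exact: qc.
by apply: filterS => y /=; rewrite lte_fin.
Qed.

Lemma usc_within_comp (T S : topologicalType) (K : set T) (L : set S)
    (p : T -> S) (f : S -> \bar R) :
  continuous p -> (forall x, K x -> L (p x)) -> usc_within L f ->
  usc_within K (fun x => f (p x)).
Proof.
move=> pc KL [fy fL]; split=> [x /KL/fy//|x Kx t ft].
have H := fL _ (KL _ Kx) _ ft.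
have H' : \forall y \near x, L (p y) -> f (p y) < t%:E := pc x _ H.
by apply: filterS H' => y py Ky; apply/py/KL.
Qed.

Lemma usc_within_sub (T : topologicalType) (K L : set T) (f : T -> \bar R) :
  L `<=` K -> usc_within K f -> usc_within L f.
Proof.
move=> LK [fy fK]; split=> [x /LK/fy//|x /LK Kx t ft].
by apply: filterS (fK x Kx t ft) => y fyt /LK.
Qed.

(** Without a maximum, every point of K is strictly dominated by some f y, and by semicontinuity so
    are its neighbours. Along the filter of upper sets of f, compactness yields one a strictly
    dominating all of K, itself included. *)
Lemma usc_within_max (T : topologicalType) (K : set T) (f : T -> \bar R) :
  compact K -> K !=set0 -> usc_within K f -> exists2 x, K x & forall y, K y -> f y <= f x.
Proof.
move=> Kc [k0 Kk0] [fy fK]; apply: contrapT => nomax.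
have step x : K x -> exists2 y, K y & f x < f y.
  move=> Kx; apply: contrapT => nox; apply: nomax; exists x => // y Ky.
  by rewrite leNgt; apply/negP => xy; apply: nox; exists y.
pose F : set_system T := fun P => exists2 a, K a & forall b, K b -> f a <= f b -> P b.
have FF : Filter F.
  split.
  - by exists k0.
  - move=> P Q [a Ka Pa] [b Kb Qb]; have [ab|/ltW ba] := leP (f a) (f b).
      by exists b => // c Kc' bc; split; [apply: Pa => //; apply: le_trans bc|apply: Qb].
    by exists a => // c Kc' ac; split; [apply: Pa|apply: Qb => //; apply: le_trans ac].
  - by move=> P Q PQ [a Ka Pa]; exists a => // b Kb ab; apply/PQ/Pa.
have /compact_near_coveringP cov := Kc.
have [a Ka Ha] : F (fun i => K `<=` [set x | K x -> f x < f i]).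
  apply: (cov _ F (fun i x => K x -> f x < f i)) => x Kx.
  have [y Ky xy] := step x Kx.
  have fyE : f y = (fine (f y))%:E.
    by rewrite fineK // fin_numE fy // andbT; apply: contraTN xy => /eqP ->; rewrite ltNge leNye.
  exists ([set z | K z -> f z < f y], [set i | f y <= f i]) => /=.
    split; last by exists y.
    by rewrite fyE; apply: fK => //; rewrite -fyE.
  by move=> [z i] [/= Hz Hi] Kz; apply: lt_le_trans (Hz Kz) Hi.
by have := Ha a Ka (lexx _) a Ka Ka; rewrite ltxx.
Qed.

End Usc.

(** * Regularization and contact points *)

Section Regularization.
Variables (R : realType) (n : nat) (S : set 'rV[R]_n) (w : 'rV[R]_n -> R).
Variables (k wmax : R).
Hypotheses (k_gt0 : 0 < k) (S_neq0 : S !=set0).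
Hypothesis w_le : forall y, S y -> w y <= wmax.
Implicit Types (x y z a b p q : 'rV[R]_n).

Local Notation sq x := (dot x x).

Definition supconv z : R := sup [set w y - k * sq (y - z) | y in S].

Lemma le_supconv y z : S y -> w y - k * sq (y - z) <= supconv z.
Proof.
move=> Sy; apply: ub_le_sup; last by exists y.
exists wmax => _ [y' Sy' <-]; have := w_le Sy'.
have : 0 <= k * sq (y' - z) by rewrite mulr_ge0 ?dot_ge0 ?(ltW k_gt0).
by lra.
Qed.

Lemma supconv_le z c : (forall y, S y -> w y - k * sq (y - z) <= c) -> supconv z <= c.
Proof.
move=> wc; apply: ge_sup; last by move=> _ [y Sy <-]; apply: wc.
by case: S_neq0 => y Sy; exists (w y - k * sq (y - z)); exists y.
Qed.

(* Lasry-Lions regularization: the infimum of all paraboloids c + 2 k |x - z|^2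
   lying above the sup-convolution sup_y (w y - 2 k |x - y|^2). *)
Definition regular x : R := inf [set supconv z + 2 * k * sq (x - z) | z in setT].

(** For a = y - x and b = x - z, the gap in k |a + b|^2 <= 2 k |a|^2 + 2 k |b|^2 is k |a - b|^2. *)
Lemma lower_paraboloid_aux y x z : S y ->
  w y - 2 * k * sq (y - x) <= supconv z + 2 * k * sq (x - z).
Proof.
move=> Sy; have := le_supconv z Sy.
have : 0 <= k * sq (y - x - (x - z)) by rewrite mulr_ge0 ?dot_ge0 ?(ltW k_gt0).
rewrite (_ : y - z = (y - x) + (x - z)); last by rewrite addrA subrK.
move: (y - x) (x - z) => a b; rewrite !dotE (dotC b a); lra.
Qed.

Lemma regular_has_inf x : has_inf [set supconv z + 2 * k * sq (x - z) | z in setT].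
Proof.
split; first by exists (supconv x + 2 * k * sq (x - x)), x.
case: S_neq0 => y Sy; exists (w y - 2 * k * sq (y - x)) => _ [z _ <-].
exact: lower_paraboloid_aux.
Qed.

Lemma regular_ge y x : S y -> w y - 2 * k * sq (y - x) <= regular x.
Proof.
move=> Sy; apply: lb_le_inf; first by case: (regular_has_inf x).
by move=> _ [z _ <-]; apply: lower_paraboloid_aux.
Qed.

Lemma regular_le x z : regular x <= supconv z + 2 * k * sq (x - z).
Proof. by apply: ge_inf; [case: (regular_has_inf x)|exists z]. Qed.

Lemma supconv_convex_comb l z1 z2 : 0 <= l <= 1 ->
  supconv ((1 - l) *: z1 + l *: z2) <=
  (1 - l) * supconv z1 + l * supconv z2 + k * (l * (1 - l) * sq (z1 - z2)).
Proof.
move=> /andP[l0 l1]; apply: supconv_le => y Sy.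
have l1' : 0 <= 1 - l by rewrite subr_ge0.
have := ler_wpM2l l1' (le_supconv z1 Sy); have := ler_wpM2l l0 (le_supconv z2 Sy).
rewrite (_ : y - (_ + _) = (1 - l) *: (y - z1) + l *: (y - z2)); last first.
  by apply/rowP => i; rewrite !mxE; ring.
rewrite dot_convex_comb (_ : y - z1 - (y - z2) = - (z1 - z2)); last first.
  by apply/rowP => i; rewrite !mxE; ring.
rewrite dotNl dotNr opprK; lra.
Qed.

(** An infimum of paraboloids of opening 2 k satisfies one side. For the other, combine
    near-minimizers z1, z2: [supconv] is semiconvex with the smaller constant k, so its loss k |z1 -
    z2|^2 is absorbed by 2 k |(x - y) - (z1 - z2)|^2 + 2 k |x - y|^2. *)
Lemma regular_C11 : C11_bound (2 * k) regular.
Proof.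
move=> l x y l01; have /andP[l0 l1] := l01; have l1' : 0 <= 1 - l by rewrite subr_ge0.
set D := l * (1 - l) * sq (x - y).
have w0 : 0 <= l * (1 - l) by rewrite mulr_ge0.
rewrite ler_norml; apply/andP; split.
  rewrite lerBrDl; apply: lb_le_inf; first by case: (regular_has_inf ((1 - l) *: x + l *: y)).
  move=> _ [z _ <-].
  have := ler_wpM2l l1' (regular_le x z); have := ler_wpM2l l0 (regular_le y z).
  rewrite (_ : _ + _ - z = (1 - l) *: (x - z) + l *: (y - z)); last first.
    by apply/rowP => i; rewrite !mxE; ring.
  rewrite dot_convex_comb (_ : x - z - (y - z) = x - y); last first.
    by apply/rowP => i; rewrite !mxE; ring.
  rewrite /D; lra.
rewrite lerBlDl; apply/ler_addgt0Pr => e e0.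
have [_ [z1 _ <-] h1] := inf_adherent e0 (regular_has_inf x).
have [_ [z2 _ <-] h2] := inf_adherent e0 (regular_has_inf y).
apply: le_trans (regular_le _ ((1 - l) *: z1 + l *: z2)) _.
have := supconv_convex_comb z1 z2 l01.
rewrite (_ : _ - (_ + _) = (1 - l) *: (x - z1) + l *: (y - z2)); last first.
  by apply/rowP => i; rewrite !mxE; ring.
rewrite dot_convex_comb (_ : x - z1 - (y - z2) = (x - y) - (z1 - z2)); last first.
  by apply/rowP => i; rewrite !mxE; ring.
have := ler_wpM2l l1' (ltW h1); have := ler_wpM2l l0 (ltW h2).
have : 0 <= k * (l * (1 - l) * sq (2 *: (x - y) - (z1 - z2))).
  by rewrite mulr_ge0 ?mulr_ge0 ?dot_ge0 ?(ltW k_gt0).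
rewrite /D; move: (x - y) (z1 - z2) => a b; rewrite !dotE (dotC b a).
rewrite -/(regular x) -/(regular y); clear; lra.
Qed.

Section Contact.
Variables (T : set 'rV[R]_n) (v : 'rV[R]_n -> R).
Variable (box : 'rV[R]_n -> Prop).
Variables (X Y : 'rV[R]_n -> 'rV[R]_n).

Definition doubled p x y : R := v x + w y - k * sq (x - y) - 2^-1 * dot p (x + y).

Hypothesis XT : forall p, box p -> T (X p).
Hypothesis YS : forall p, box p -> S (Y p).
Hypothesis XY_max : forall p x y, box p -> T x -> S y ->
  doubled p x y <= doubled p (X p) (Y p).

(* Maximizing v x + w y - 2 k |x - z|^2 - 2 k |y - z|^2 - p . z over (x, y, z)
   amounts to maximizing [doubled p] over (x, y), the optimal z being
   [contact p]. *)
Definition contact p := 2^-1 *: (X p + Y p) - (8 * k)^-1 *: p.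

(** The maximal value over (x, y, z): minimizing 2 k |x - z|^2 + 2 k |y - z|^2 + p . z over z leaves
    k |x - y|^2 + p . (x + y) / 2 - |p|^2 / (16 k). *)
Let c p := doubled p (X p) (Y p) + (16 * k)^-1 * sq p.

(** The right-hand side is a paraboloid in z of opening 2 k above w y - 2 k |y - z|^2 for every y in
    S, and [regular] is the infimum of those. Completing the square puts its centre at x - p / (4
    k). *)
Lemma regular_upper p x z : box p -> T x ->
  regular z <= c p + dot p z - v x + 2 * k * sq (x - z).
Proof.
move=> bp Tx; apply: le_trans (regular_le z (x - (4 * k)^-1 *: p)) _.
rewrite -lerBrDr; apply: supconv_le => y Sy; have := XY_max bp Tx Sy.
rewrite /c; set m := doubled p (X p) (Y p).
rewrite /doubled (_ : y - (x - _) = - (x - y) + (4 * k)^-1 *: p); last first.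
  by apply/rowP => i; rewrite !mxE; ring.
rewrite (_ : z - (x - _) = - (x - z) + (4 * k)^-1 *: p); last first.
  by apply/rowP => i; rewrite !mxE; ring.
rewrite (_ : x + y = 2 *: x - (x - y)); last first.
  by apply/rowP => i; rewrite !mxE; ring.
rewrite [in dot p z](_ : z = x - (x - z)); last by rewrite opprB addrC subrK.
move: (x - y) (x - z) => a b; rewrite !dotE !(dotC _ p).
have -> : (16 * k)^-1 = (4 * k)^-1 / 4 by field; rewrite gt_eqF.
have kE : k * (4 * k)^-1 = 4^-1 by field; rewrite gt_eqF.
move: (4 * k)^-1 kE => j kE mx.
have kjE u : k * j * u = 4^-1 * u by rewrite kE.
have := kjE (dot p a); have := kjE (dot p b); have := kjE (j * sq p).
by move: mx; lra.
Qed.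

(** With x, y frozen at X p, Y p, the maximized expression is quadratic in z, with maximum [c p] at
    [contact p] and leading part -4 k |z|^2; [regular_ge] then replaces w (Y p). *)
Lemma contact_lower p z : box p ->
  c p + dot p z - 4 * k * sq (z - contact p) <= regular z + v (X p) - 2 * k * sq (X p - z).
Proof.
move=> bp; have := regular_ge z (YS bp); rewrite /c /contact /doubled.
move: (v (X p)) (w (Y p)) (regular z) (X p) (Y p) => vx wy rz x y.
rewrite (_ : x - y = (x - z) - (y - z)); last by rewrite opprB addrA subrK.
rewrite (_ : x + y = (x - z) + (y - z) + 2 *: z); last first.
  by apply/rowP => i; rewrite !mxE; ring.
rewrite (_ : z - _ = - (2^-1 *: ((x - z) + (y - z))) + (8 * k)^-1 *: p); last first.
  by apply/rowP => i; rewrite !mxE; field; rewrite gt_eqF.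
move: (x - z) (y - z) => a b; rewrite !dotE !(dotC _ p) (dotC b a).
have -> : (16 * k)^-1 = (8 * k)^-1 / 2 by field; rewrite gt_eqF.
have kE : k * (8 * k)^-1 = 8^-1 by field; rewrite gt_eqF.
move: (8 * k)^-1 kE => j kE.
have kjE u : k * j * u = 8^-1 * u by rewrite kE.
have := kjE (dot p a); have := kjE (dot p b); have := kjE (j * sq p).
by lra.
Qed.

(** The lower bound from Y p and the upper bound from X p coincide at [contact p], so both are
    attained. *)
Lemma regular_contact p : box p ->
  regular (contact p) = w (Y p) - 2 * k * sq (Y p - contact p) /\
  regular (contact p) =
    c p + dot p (contact p) - v (X p) + 2 * k * sq (X p - contact p).
Proof.
move=> bp; have h1 := regular_ge (contact p) (YS bp).
have h2 := regular_upper (contact p) bp (XT bp).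
suff e : c p + dot p (contact p) - v (X p) + 2 * k * sq (X p - contact p) =
    w (Y p) - 2 * k * sq (Y p - contact p) by split; lra.
rewrite /c /contact /doubled; move=> {h1 h2}.
move: (v (X p)) (w (Y p)) (X p) (Y p) => vx wy x y.
rewrite (_ : x - (_ - _) = 2^-1 *: (x - y) + (8 * k)^-1 *: p); last first.
  by apply/rowP => i; rewrite !mxE; field; rewrite gt_eqF.
rewrite (_ : y - (_ - _) = - (2^-1 *: (x - y)) + (8 * k)^-1 *: p); last first.
  by apply/rowP => i; rewrite !mxE; field; rewrite gt_eqF.
have -> : (16 * k)^-1 = (8 * k)^-1 / 2 by field; rewrite gt_eqF.
have kE : k * (8 * k)^-1 = 8^-1 by field; rewrite gt_eqF.
move: (x - y) (x + y) => a b; rewrite !dotE !(dotC _ p).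
move: (8 * k)^-1 kE => j kE.
have kjE u : k * j * u = 8^-1 * u by rewrite kE.
have := kjE (dot p a); have := kjE (dot p b); have := kjE (j * sq p).
by lra.
Qed.

(* v and w have sup-convolutions whose sum is touched at [contact p] from above
   by an affine function of slope p and from below by a paraboloid. *)
Lemma contact_separated p q s : box p -> box q ->
  (forall i, `|contact p 0 i - contact q 0 i| <= s) ->
  forall i, `|p 0 i - q 0 i| <= 16 * k * n.+1%:R * s.
Proof.
move=> bp bq close i.
have s0 : 0 <= s by apply: le_trans (close i).
have below p' q' z : box p' -> box q' ->
    c p' + dot p' z - 4 * k * sq (z - contact p') <= c q' + dot q' z.
  move=> bp' bq'; apply: le_trans (contact_lower z bp') _.
  by have := regular_upper z bq' (XT bp'); lra.
(* Testing the paraboloid of p at a step (p - q) / (16 k) from the contact point of q, and the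
   paraboloid of q at that contact point, gives |p - q| <= 16 k |contact p - contact q|; [n.+1]
   covers the passage to coordinates. *)
have h1 := below p q (contact q + (16 * k)^-1 *: (p - q)) bp bq.
have := below q p (contact q) bq bp; rewrite subrr dot0l mulr0 subr0 => h2.
have D : sq (contact p - contact q) <= n%:R * (s * s).
  apply: le_trans (ler_norm _) _.
  by apply: dot_le => j; rewrite mxE [X in `|_ + X|]mxE; apply: close.
have : sq (p - q) <= (16 * k) ^+ 2 * (n%:R * (s * s)).
  apply: le_trans (_ : (16 * k) ^+ 2 * sq (contact p - contact q) <= _); last first.
    by rewrite ler_wpM2l ?sqr_ge0.
  move: h1; rewrite (_ : contact q + _ - contact p =
    - (contact p - contact q) + (16 * k)^-1 *: (p - q)); last first.
    by apply/rowP => j; rewrite !mxE; ring.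
  have : 0 <= k * sq (contact p - contact q + (16 * k)^-1 *: (p - q)).
    by rewrite mulr_ge0 ?dot_ge0 ?(ltW k_gt0).
  have pE u : dot p u = dot q u + dot (p - q) u by rewrite -dotDl addrC subrK.
  have J0 : 0 < (16 * k)^-1 by rewrite invr_gt0 mulr_gt0.
  have kE : k * (16 * k)^-1 = 16^-1 by field; rewrite gt_eqF.
  have JE : (16 * k)^-1 * (16 * k) ^+ 2 = 16 * k by field; rewrite gt_eqF.
  move=> a1 a2; rewrite -(ler_pM2l J0) [leRHS]mulrA JE.
  move: h2 a1 a2; rewrite !pE.
  move: (contact q) (contact p - contact q) (p - q) (16 * k)^-1 kE {J0 JE pE below D}.
  move=> b a e J kE; rewrite !dotE (dotC e a).
  have kJE u : k * J * u = 16^-1 * u by rewrite kE.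
  have := kJE (dot a e); have := kJE (J * sq e); lra.
move=> le_pq.
have : `|p 0 i - q 0 i| ^+ 2 <= (16 * k * n.+1%:R * s) ^+ 2.
  rewrite -normrX ger0_norm ?sqr_ge0 //.
  have -> : p 0 i - q 0 i = (p - q) 0 i by rewrite !mxE.
  apply: le_trans (sqr_coord_le_dot _ _) (le_trans le_pq _).
  rewrite [leRHS](_ : _ = (16 * k) ^+ 2 * (n.+1%:R ^+ 2 * (s * s))); last by ring.
  rewrite ler_wpM2l ?sqr_ge0 // ler_wpM2r ?mulr_ge0 // -natrX ler_nat.
  by rewrite (leq_trans (leqnSn n)) // leq_pmulr.
rewrite ler_pXn2r // nnegrE ?normr_ge0 // !mulr_ge0 //.
exact: ltW.
Qed.

End Contact.

End Regularization.

(** * Quadratic test functions *)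

Section QuadraticTests.
Variables (R : realType) (n : nat).
Implicit Types (x y z l : 'rV[R]_n) (A : 'M[R]_n).

Definition coord_cont (T : topologicalType) (f : T -> 'rV[R]_n) :=
  forall i, continuous (fun t => f t 0 i).

Lemma coord_contD (T : topologicalType) (f g : T -> 'rV[R]_n) :
  coord_cont f -> coord_cont g -> coord_cont (fun t => f t + g t).
Proof.
move=> fc gc i t; under eq_fun do rewrite mxE.
by apply: cvgD; [exact: fc|exact: gc].
Qed.

Lemma coord_contN (T : topologicalType) (f : T -> 'rV[R]_n) :
  coord_cont f -> coord_cont (fun t => - f t).
Proof. by move=> fc i t; under eq_fun do rewrite mxE; apply: cvgN; exact: fc. Qed.

Lemma coord_cont_cst (T : topologicalType) z : coord_cont (fun _ : T => z).
Proof. by move=> i; exact: cst_continuous. Qed.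

Lemma continuous_coord_cont (T : topologicalType) (f : T -> 'rV[R]_n) :
  continuous f -> coord_cont f.
Proof.
move=> fc i t; apply: (@cvg_comp _ _ _ f (fun M : 'rV[R]_n => M 0 i) _ (nbhs (f t))).
  exact: fc.
exact: coord_continuous.
Qed.

Lemma coord_cont_id : coord_cont (fun x : 'rV[R]_n => x).
Proof. by apply: continuous_coord_cont => x; exact: cvg_id. Qed.

Lemma sum_continuous (T : topologicalType) (f : 'I_n -> T -> R) :
  (forall i, continuous (f i)) -> continuous (fun t => \sum_i f i t).
Proof.
move=> fc; elim: (index_enum _) => [|i s IH] t.
  by under eq_fun do rewrite big_nil; exact: cvg_cst.
under eq_fun do rewrite big_cons.
by apply: cvgD; [exact: fc|exact: IH].
Qed.

Lemma coord_contM (T : topologicalType) (f : T -> 'rV[R]_n) A :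
  coord_cont f -> coord_cont (fun t => f t *m A).
Proof.
move=> fc i; have -> : (fun t => (f t *m A) 0 i) = (fun t => \sum_j f t 0 j * A j i).
  by apply/funext => t; rewrite mxE.
by apply: sum_continuous => j t; apply: cvgM; [exact: fc|exact: cvg_cst].
Qed.

Lemma dot_continuous (T : topologicalType) (f g : T -> 'rV[R]_n) :
  coord_cont f -> coord_cont g -> continuous (fun t => dot (f t) (g t)).
Proof.
by move=> fc gc; apply: sum_continuous => i t; apply: cvgM; [exact: fc|exact: gc].
Qed.

Lemma quad_continuous y l A : continuous (quad y l A).
Proof.
have idc : coord_cont (fun x => x - y).
  by apply: coord_contD; [exact: coord_cont_id|exact: coord_cont_cst].
have c1 : continuous (fun x => dot l (x - y)).
  by apply: (@dot_continuous _ (fun=> l)) => //; exact: coord_cont_cst.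
have c2 : continuous (fun x => dot ((x - y) *m A) (x - y)).
  by apply: (@dot_continuous _ (fun x => (x - y) *m A)) => //; exact: coord_contM.
by move=> x; exact: cvgD (c1 x) (cvgM (cvg_cst _) (c2 x)).
Qed.

Lemma is_derive_poly2 (f : 'rV[R]_n -> R) x v a b :
  (forall h : R, f (h *: v + x) = f x + h * a + h ^+ 2 * b) -> is_derive x v f a.
Proof.
move=> fE.
have H : (fun h : R => h^-1 *: ((f \o shift x) (h *: v) - f x)) @ 0^' --> a.
  apply: cvg_trans (_ : (fun h : R => a + h * b) @ 0^' --> a).
    apply: near_eq_cvg; near=> h.
    have h0 : h != 0 by near: h; exact: nbhs_dnbhs_neq.
    by rewrite /= fE /GRing.scale /=; field.
  rewrite -[X in _ --> X]addr0 -[X in _ + X](mul0r b).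
  apply: cvgD; first exact: cvg_cst.
  apply: cvgM; last exact: cvg_cst.
  exact: nbhs_dnbhs.
apply: DeriveDef; first by apply/cvg_ex; exists a.
exact: cvg_lim.
Unshelve. all: by end_near. Qed.

Lemma pder_quad c y l A i x : A^T = A ->
  is_derive x (evec R i) (fun x => c + quad y l A x) ((l + (x - y) *m A) 0 i).
Proof.
move=> sA; apply: (@is_derive_poly2 _ _ _ _ (2^-1 * A i i)) => h.
rewrite [_ *: _ + x]addrC quad_recenter // /evec -scalemxAl dotZl !dotZr.
by rewrite dot_delta_mx dot_deltar; ring.
Qed.

Lemma C2_quad c y l A x : A^T = A -> C2_near (fun x => c + quad y l A x) x.
Proof.
move=> sA.
have p1 i : pder i (fun x => c + quad y l A x) = (fun x => (l + (x - y) *m A) 0 i).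
  by apply/funext => z; have := pder_quad c y l i z sA => h; exact: derive_val.
have d2 i j z : is_derive z (evec R i) (fun x => (l + (x - y) *m A) 0 j) (A i j).
  apply: (@is_derive_poly2 _ _ _ _ 0) => h.
  rewrite -addrA mulmxDl -scalemxAl /evec -rowE !mxE; ring.
have p2 i j : pder i (pder j (fun x => c + quad y l A x)) = (fun=> A i j).
  by rewrite p1; apply/funext => z; have := d2 i j z => h; exact: derive_val.
have cc : coord_cont (fun x => l + (x - y) *m A).
  apply: coord_contD; first exact: coord_cont_cst.
  by apply/coord_contM/coord_contD; [exact: coord_cont_id|exact: coord_cont_cst].
exists setT; split; first exact: openT.
split=> //; split; [|split; [|split; [|split]]].
- by move=> z _; exact: cvgD (cvg_cst _) (@quad_continuous y l A z).
- by move=> i z _; have := pder_quad c y l i z sA => h; exact: ex_derive.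
- by move=> i z _; rewrite p1; exact: cc.
- by move=> i j z _; rewrite p1; have := d2 i j z => h; exact: ex_derive.
- by move=> i j z _; rewrite p2; exact: cst_continuous.
Qed.

Lemma hessian_quad c y l A x : A^T = A -> hessian (fun x => c + quad y l A x) x = A.
Proof.
move=> sA; apply/matrixP => i j; rewrite mxE.
have p1 : pder j (fun x => c + quad y l A x) = (fun x => (l + (x - y) *m A) 0 j).
  by apply/funext => z; have := pder_quad c y l j z sA => h; exact: derive_val.
rewrite p1; have h : is_derive x (evec R i) (fun x => (l + (x - y) *m A) 0 j) (A i j).
  apply: (@is_derive_poly2 _ _ _ _ 0) => h.
  by rewrite -addrA mulmxDl -scalemxAl /evec -rowE !mxE; ring.
exact: derive_val.
Qed.

End QuadraticTests.

(** * The sup norm against the Euclidean form *)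

Section Norms.
Variables (R : realType) (n : nat).
Implicit Types (x y z : 'rV[R]_n) (A B : 'M[R]_n).

Lemma row_norm_le z (r : R) : 0 <= r -> (`|z| <= r) <-> (forall i, `|z 0 i| <= r).
Proof.
move=> r0; rewrite [`|z|]mx_normrE; split=> [zr i|zr].
  exact: le_trans (le_bigmax _ (fun ij => `|z ij.1 ij.2|) (0, i)) zr.
by apply: bigmax_le => // -[i j] _ /=; rewrite ord1.
Qed.

Lemma mx_entry_le m (M : 'M[R]_(m, n)) i j : `|M i j| <= `|M|.
Proof.
rewrite [leRHS]mx_normrE.
exact: (le_bigmax _ (fun ij => `|M ij.1 ij.2|) (i, j)).
Qed.

Lemma dot_mx_le A z (e : R) : (forall i j, `|A i j| <= e) ->
  `|dot (z *m A) z| <= e * n%:R * dot z z.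
Proof.
move=> Ae; rewrite /dot; under eq_bigr do rewrite mxE mulr_suml.
apply: le_trans (ler_norm_sum _ _ _) _.
apply: le_trans (_ : \sum_i \sum_j e * ((z 0 i ^+ 2 + z 0 j ^+ 2) / 2) <= _).
  apply: ler_sum => i _; apply: le_trans (ler_norm_sum _ _ _) _.
  apply: ler_sum => j _; rewrite -mulrA mulrCA normrM.
  apply: ler_pM => //; rewrite ler_norml.
  by apply/andP; split; [have := sqr_ge0 (z 0 i + z 0 j)|have := sqr_ge0 (z 0 i - z 0 j)]; nra.
have sE : \sum_i z 0 i ^+ 2 = \sum_i z 0 i * z 0 i.
  by apply: eq_bigr => i _; rewrite expr2.
under eq_bigr do rewrite -mulr_sumr -mulr_suml big_split /= sumr_const card_ord sE.
rewrite -mulr_sumr -mulr_suml big_split /= sumr_const card_ord sumrMnl sE.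
set S := \sum_i z 0 i * z 0 i; rewrite -[S *+ n]mulr_natl.
by clear; lra.
Qed.

Lemma sqr_norm_le_dot z : `|z| ^+ 2 <= dot z z.
Proof.
rewrite -[leRHS]sqr_sqrtr ?dot_ge0 // lerXn2r ?nnegrE ?sqrtr_ge0 //.
apply/row_norm_le; rewrite ?sqrtr_ge0 // => i.
by rewrite -sqrtr_sqr ler_wsqrtr // sqr_coord_le_dot.
Qed.

End Norms.

(** * From approximate to exact touching *)

Section Sliding.
Variables (R : realType) (n : nat).
Implicit Types (x y z l : 'rV[R]_n) (A B : 'M[R]_n) (u : 'rV[R]_n -> \bar R).
Implicit Types (F G : set 'M[R]_n) (X D K : set 'rV[R]_n).

(** Viscosity test by quadratics, the form in which restriction and rescaling become algebra. *)
Definition quad_sub G X u : Prop :=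
  forall x0, X x0 -> forall A l (c : R), A^T = A -> u x0 = c%:E ->
    (\forall x \near x0, X x -> (u x <= (c + quad x0 l A x)%:E)%E) -> G A.

Lemma quad_base y l A : quad y l A y = 0.
Proof. by rewrite /quad subrr mul0mx !dotE mulr0 addr0. Qed.

Lemma subharmonic_quad_sub G X u : subharmonic G X u -> quad_sub G X u.
Proof.
move=> [_ sub] x0 Xx0 A l c sA ux0 near_x0.
rewrite -(hessian_quad c x0 l x0 sA); apply: sub => //; first exact: C2_quad.
by rewrite quad_base addr0.
Qed.

Lemma quad_sub_open G X D u : open D -> D `<=` X -> quad_sub G X u -> quad_sub G D u.
Proof.
move=> oD DX sub x0 Dx0 A l c sA ux0 near_x0; apply: (sub x0 (DX _ Dx0) A l c) => //.
have nD : nbhs x0 D by apply: open_nbhs_nbhs.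
by apply: filterS2 near_x0 nD => x h Dx _; apply: h.
Qed.

(** A perturbation with entries at most k / (n + 1) has a quadratic form of size at most k |z|^2, so
    adding k I makes it positive semidefinite. *)
Lemma sym_interior_add F A (k : R) : cone_subequation F -> 0 < k -> F A ->
  sym_interior F (A + k%:M).
Proof.
move=> [Fs _ Fp _] k0 FA; have sA := Fs _ FA.
have sk : (k%:M : 'M[R]_n)^T = k%:M by rewrite tr_scalar_mx.
split; first by rewrite /symm linearD /= sA sk.
exists (k / n.+1%:R); first by rewrite divr_gt0.
move=> B sB AB; have -> : B = A + (B - A) by rewrite addrC subrK.
apply: Fp => //; split; first by rewrite /symm linearB /= sA sB.
move=> z; rewrite mx11_dot; set E := B - (A + k%:M).
have -> : B - A = E + k%:M by rewrite /E opprD addrA subrK.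
have Ee i j : `|E i j| <= k / n.+1%:R.
  by apply: le_trans (mx_entry_le _ _ _) (ltW AB).
have := dot_mx_le z Ee; rewrite ler_norml => /andP[h _].
rewrite mulmxDr dotDl dot_scalar_mx -lerBlDr sub0r.
apply: le_trans h; rewrite lerN2.
rewrite ler_wpM2r ?dot_ge0 // mulrAC ler_pdivrMr //.
by rewrite ler_wpM2l ?(ltW k0) // ler_nat.
Qed.

Lemma near_norm_lt y (r : R) x : `|x - y| < r -> \forall z \near x, `|z - y| <= r.
Proof.
move=> xr; apply/nbhs_ballP; exists (r - `|x - y|) => /=; first by rewrite subr_gt0.
move=> z; rewrite -ball_normE /= distrC => zx.
have -> : z - y = (z - x) + (x - y) by rewrite addrA subrK.
by apply: le_trans (ler_normD _ _) _; lra.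
Qed.

(* Slide the quadratic until it touches u from above near y; the extra 4 d
   pushes the touching point off the boundary of the ball. *)
Lemma touching_quad G D K u y (a rho d : R) l A :
  compact K -> usc_within K u -> open D -> D `<=` K -> quad_sub G D u ->
  K y -> u y = a%:E -> 0 < rho -> 0 < d -> A^T = A ->
  (forall x, K x -> `|x - y| <= rho -> D x) ->
  (forall x, K x -> `|x - y| <= rho ->
    (u x <= (a + quad y l A x + d * rho ^+ 2)%:E)%E) ->
  G (A + (4 * d)%:M).
Proof.
move=> Kc uK oD DK sub Ky uy rho0 d0 sA inD le_u.
pose A' := A + (4 * d)%:M.
have sA' : A'^T = A' by rewrite linearD /= sA tr_scalar_mx.
have qE x : quad y l A' x = quad y l A x + 2 * d * dot (x - y) (x - y).
  by rewrite /quad /A' mulmxDr dotDl dot_scalar_mx; lra.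
pose K' := K `&` [set x | `|x - y| <= rho].
have K'c : compact K'.
  apply: compact_closedI => //.
  have -> : [set x | `|x - y| <= rho] = closed_ball_ Num.norm y rho.
    by apply/seteqP; split => x /=; rewrite distrC.
  exact: closed_closed_ball_.
have K'y : K' y by split=> //=; rewrite subrr normr0 ltW.
have uscf : usc_within K' (fun x => (u x + (- quad y l A' x)%:E)%E).
  apply: usc_within_add; first by apply: usc_within_sub uK => x [].
  by apply: usc_within_continuous => x; exact: cvgN (@quad_continuous _ _ y l A' x).
have [x1 [Kx1 /= x1r] x1max] := usc_within_max K'c (ex_intro _ y K'y) uscf.
have := x1max y K'y; rewrite uy quad_base oppr0 adde0 => ax1.
have [b ub] : exists b : R, u x1 = b%:E.
  case: (u x1) ax1 (uK.1 x1 Kx1) => [b _ _|//|]; first by exists b.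
  by rewrite addNye.
(* On the sphere the extra 2 d |x - y|^2 is at least 2 d rho^2 and beats the error d rho^2, whereas
   the maximum is at least the value a at y. *)
have x1lt : `|x1 - y| < rho.
  rewrite lt_neqAle x1r andbT; apply/eqP => x1E.
  have := le_u x1 Kx1 x1r; move: ax1; rewrite ub -EFinD !lee_fin qE.
  have : rho ^+ 2 <= dot (x1 - y) (x1 - y) by rewrite -x1E sqr_norm_le_dot.
  move=> rd; have := ler_wpM2l (ltW d0) rd.
  have : 0 < d * rho ^+ 2 by rewrite mulr_gt0 ?exprn_gt0.
  lra.
have Dx1 := inD x1 Kx1 x1r.
apply: (sub x1 Dx1 A' (l + (x1 - y) *m A') b) => //.
have := near_norm_lt x1lt; apply: filterS => x xr Dx.
have := x1max x (conj (DK _ Dx) xr); rewrite ub -EFinD.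
case: (u x) (uK.1 x (DK _ Dx)) => [c| |] // _; last by move=> _; exact: leNye.
rewrite -EFinD !lee_fin; have := quad_recenter x1 y l (x - x1) sA'.
rewrite addrC subrK /quad; lra.
Qed.

End Sliding.

(** * The comparison principle *)

Section Comparison.
Variables (R : realType) (n : nat).
Implicit Types (x y z p : 'rV[R]_n) (K D : set 'rV[R]_n) (u v w : 'rV[R]_n -> \bar R).

Definition finite_on K u : set 'rV[R]_n := [set x | K x /\ u x != -oo%E].

Lemma finite_onE K u x : usc_within K u -> finite_on K u x -> u x = (fine (u x))%:E.
Proof. by move=> [uy _] [/uy + uNy]; case: (u x) uNy. Qed.

Lemma usc_bounded_above K u : compact K -> usc_within K u ->
  exists M : R, forall x, K x -> (u x <= M%:E)%E.
Proof.
move=> Kc uK; have [[x0 Kx0]|K0] := pselect (K !=set0); last first.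
  by exists 0 => x Kx; case: K0; exists x.
have [x Kx xmax] := usc_within_max Kc (ex_intro _ x0 Kx0) uK.
exists (fine (u x)) => y Ky; apply: le_trans (xmax y Ky) _.
by case: (u x) (uK.1 x Kx) => // _; rewrite leNye.
Qed.

(** The maximum over K x K is at least the finite value at (x0, x0), so v and w are finite where it
    is attained. *)
Lemma doubled_max K v w x0 (q : 'rV[R]_n * 'rV[R]_n -> R) :
  compact K -> usc_within K v -> usc_within K w -> continuous q ->
  finite_on K v x0 -> finite_on K w x0 ->
  exists xy, [/\ finite_on K v xy.1, finite_on K w xy.2 &
    forall x y, finite_on K v x -> finite_on K w y ->
      fine (v x) + fine (w y) + q (x, y) <= fine (v xy.1) + fine (w xy.2) + q xy].
Proof.
move=> Kc vK wK qc vx0 wx0.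
have uscf : usc_within (K `*` K) (fun xy => (v xy.1 + w xy.2 + (q xy)%:E)%E).
  apply: usc_within_add; last exact: usc_within_continuous.
  apply: usc_within_add.
    by apply: (usc_within_comp (L := K)) => [[x y]|[x y] []|//] //=; exact: cvg_fst.
  by apply: (usc_within_comp (L := K)) => [[x y]|[x y] []|//] //=; exact: cvg_snd.
have [|[x y] [/= Kx Ky] xymax] := usc_within_max (compact_setX Kc Kc) _ uscf.
  by exists (x0, x0); split; [case: vx0|case: wx0].
have := xymax (x0, x0) (conj vx0.1 wx0.1) => /=.
rewrite (finite_onE vK vx0) (finite_onE wK wx0) -!EFinD => max0.
have [vx wy] : v x != -oo%E /\ w y != -oo%E.
  case: (v x) (w y) max0 (vK.1 x Kx) (wK.1 y Ky) => [a| |] [b| |] //=;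
  by rewrite leeNy_eq.
exists (x, y); split=> [||x' y' vx' wy'] //=.
have := xymax (x', y') (conj vx'.1 wy'.1) => /=.
rewrite (finite_onE vK vx') (finite_onE wK wy').
by rewrite (@finite_onE K v x vK) // (@finite_onE K w y wK).
Qed.

(** Semicontinuity at a boundary point bounds v x + w y for independent x and y nearby; compactness
    of K minus D makes the radius uniform. *)
Lemma boundary_gap K D v w (m : R) : compact K -> open D ->
  usc_within K v -> usc_within K w -> 0 < m ->
  (forall x, K x -> ~ D x -> (v x + w x <= 0)%E) ->
  exists2 rho : R, 0 < rho & forall z, K z -> ~ D z -> forall x y, K x -> K y ->
    `|x - z| <= 2 * rho -> `|y - z| <= 2 * rho -> (v x + w y < m%:E)%E.
Proof.
move=> Kc oD vK wK m0 vw0.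
have KDc : compact (K `&` ~` D) by apply: compact_closedI => //; exact: open_closedC.
have /compact_near_coveringP cov := KDc.
pose P (rho : R) z := forall x y, K x -> K y ->
    `|x - z| <= 2 * rho -> `|y - z| <= 2 * rho -> (v x + w y < m%:E)%E.
have [z [Kz nDz]|e /= e0 He] := cov R 0^'+ P _ _.
  have [r [s [vr ws rs]]] : exists r s : R, [/\ (v z < r%:E)%E, (w z < s%:E)%E & r + s <= m].
    apply: lte_add_split; [exact: vK.1|exact: wK.1|].
    by apply: le_lt_trans (vw0 z Kz nDz) _; rewrite lte_fin.
  have [e1 /= e10 He1] : nbhs_ball z (fun x => K x -> (v x < r%:E)%E).
    by apply/nbhs_ballP; exact: vK.2.
  have [e2 /= e20 He2] : nbhs_ball z (fun x => K x -> (w x < s%:E)%E).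
    by apply/nbhs_ballP; exact: wK.2.
  pose e := Num.min e1 e2.
  have e0 : 0 < e by rewrite lt_min e10.
  exists (ball z (e / 3), [set t : R | t < e / 3]).
    split=> /=; first by apply: nbhsx_ballx; rewrite divr_gt0.
    by apply: nbhs_right_lt; rewrite divr_gt0.
  move=> [z' t] /= [zz' te] x y Kx Ky xz yz.
  have close a : `|a - z'| <= 2 * t -> `|z - a| < e.
    move: zz'; rewrite -ball_normE /= => zz' az.
    have -> : z - a = (z - z') - (a - z') by rewrite opprB addrA subrK.
    by apply: le_lt_trans (ler_normB _ _) _; lra.
  apply: lt_le_trans (_ : (r + s)%:E <= _)%E; last by rewrite lee_fin.
  rewrite EFinD; apply: lteD.
    apply: He1 => //; rewrite -ball_normE /=; apply: lt_le_trans (close _ xz) _.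
    by rewrite ge_min lexx.
  apply: He2 => //; rewrite -ball_normE /=; apply: lt_le_trans (close _ yz) _.
  by rewrite ge_min lexx orbT.
exists (e / 2); first by rewrite divr_gt0.
move=> z Kz nDz; apply: (He (e / 2)) => //=.
- by rewrite sub0r normrN gtr0_norm ?divr_gt0 //; lra.
- by rewrite divr_gt0.
Qed.

End Comparison.

Section ComparisonPrinciple.
Variables (R : realType) (n : nat).
Implicit Types (x y z p : 'rV[R]_n) (K D : set 'rV[R]_n) (u v w : 'rV[R]_n -> \bar R).
Implicit Types (F : set 'M[R]_n).

(* At the contact point given by [C11_near_quad] the regularization of w is
   within d s^2 of a quadratic with Hessian A on a ball of radius s; it bounds
   w from above near Y p, and an affine function minus it bounds v + t |x|^2 / 2
   from above near X p. *)
Lemma doubling_contradiction F K D v w (k t r rho : R) (X Y : 'rV[R]_n -> 'rV[R]_n) :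
  let T := finite_on K v in let S := finite_on K w in
  let v' := fun x => fine (v x) + t / 2 * dot x x in
  let w' := fun x => fine (w x) in
  let box := fun p : 'rV[R]_n => forall i, 0 <= p 0 i <= r in
  cone_subequation F -> compact K -> open D -> D `<=` K ->
  usc_within K v -> usc_within K w -> quad_sub F D v -> quad_sub (dual F) D w ->
  0 < k -> 0 < t -> 0 < r -> 0 < rho ->
  (forall p, box p -> T (X p)) -> (forall p, box p -> S (Y p)) ->
  (forall p x y, box p -> T x -> S y ->
    doubled w' k v' p x y <= doubled w' k v' p (X p) (Y p)) ->
  (forall p x, box p -> K x -> `|x - X p| <= rho -> D x) ->
  (forall p x, box p -> K x -> `|x - Y p| <= rho -> D x) ->
  False.
Proof.
move=> T S v' w' box Fcone Kc oD DK vK wK subv subw k0 t0 r0 rho0 XT YS XYmax XD YD.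
have box0 : box 0 by move=> i; rewrite mxE lexx ltW.
have Sne : S !=set0 by exists (Y 0); apply: YS.
have [wmax w'le] : exists M, forall y, S y -> w' y <= M.
  have [M wM] := usc_bounded_above Kc wK; exists M => y Sy.
  by have := wM y Sy.1; rewrite (finite_onE wK Sy) lee_fin.
pose G := regular S w' k.
have GC : C11_bound (2 * k) G := regular_C11 k0 Sne w'le.
have [Rb Kb] : exists Rb, forall x, K x -> forall i, `|x 0 i| <= Rb.
  have [M [_ HM]] := compact_bounded Kc; exists (`|M| + 1) => x Kx i.
  apply: le_trans (mx_entry_le _ _ _) _; apply: HM => //.
  by apply: le_lt_trans (ler_norm _) _; rewrite ltrDl.
pose xi := contact k X Y.
have k8 : 0 < 8 * k by rewrite mulr_gt0.
have xiB p i : box p -> `|xi p 0 i| <= Rb + r / (8 * k).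
  move=> bp; have := Kb _ (XT p bp).1 i; have := Kb _ (YS p bp).1 i.
  have /andP[p0 pr] := bp i.
  have : 0 <= (8 * k)^-1 * p 0 i <= r / (8 * k).
    have k8i : 0 <= (8 * k)^-1 by rewrite invr_ge0 ltW.
    by rewrite mulr_ge0 //= mulrC ler_wpM2r.
  rewrite /xi /contact !mxE !ler_norml => /andP[? ?] /andP[? ?] /andP[? ?].
  by apply/andP; split; lra.
(* The margin t is spent as 4 d on touching v, 4 d on touching w and 4 d on entering the interior of
   F. *)
have d0 : 0 < t / 12 by rewrite divr_gt0.
have g0 : 0 < 16 * k * n.+1%:R by rewrite !mulr_gt0.
have sep p q s : box p -> box q -> (forall i, `|xi p 0 i - xi q 0 i| <= s) ->
    forall i, `|p 0 i - q 0 i| <= 16 * k * n.+1%:R * s.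
  move=> bp bq; exact: (contact_separated k0 Sne w'le XT YS XYmax).
have k20 : 0 <= 2 * k by rewrite mulr_ge0 // ltW.
have [p [s [A [l [bp /andP[s0 srho] sA near]]]]] :=
  C11_near_quad k20 GC r0 g0 d0 rho0 xiB sep.
have [Gw Gv] := regular_contact k0 Sne w'le XT YS XYmax bp.
have coord z : `|z| <= s -> forall i, `|z 0 i| <= s.
  by move/(row_norm_le _ (ltW s0)).
set d := t / 12 in d0 near.
have FA : F (- A - t%:M + (4 * d)%:M).
  apply: (touching_quad (rho := s) (y := X p) (a := fine (v (X p)))
    (l := p - l - t *: X p) Kc vK oD DK subv) => //.
  - exact: (XT p bp).1.
  - exact: finite_onE vK (XT p bp).
  - by rewrite linearB linearN /= sA tr_scalar_mx.
  - by move=> x Kx xs; apply: XD bp Kx (le_trans xs srho).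
  move=> x Kx xs; have [vx|/negP/negPn/eqP ->] := pselect (v x != -oo%E); last by rewrite leNye.
  rewrite (finite_onE vK (conj Kx vx)) lee_fin.
  have := regular_upper k0 Sne w'le XYmax (xi p + (x - X p)) bp (conj Kx vx).
  have := near _ (coord _ xs); rewrite ler_norml => /andP[+ _].
  rewrite -/G -/xi; move: Gv; rewrite -/G -/xi.
  rewrite (_ : x - (xi p + (x - X p)) = X p - xi p); last first.
    by apply/rowP => i; rewrite !mxE; ring.
  rewrite /v' /quad mulmxBr mulmxN [in dot x x](_ : x = X p + (x - X p)); last first.
    by rewrite addrC subrK.
  rewrite mul_mx_scalar; move: (x - X p) => z; rewrite !dotE (dotC z (X p)); lra.
have dualA : dual F (A + (4 * d)%:M).
  apply: (touching_quad (rho := s) (y := Y p) (a := fine (w (Y p))) (l := l)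
    Kc wK oD DK subw) => //.
  - exact: (YS p bp).1.
  - exact: finite_onE wK (YS p bp).
  - by move=> x Kx xs; apply: YD bp Kx (le_trans xs srho).
  move=> x Kx xs; have [wx|/negP/negPn/eqP ->] := pselect (w x != -oo%E); last by rewrite leNye.
  rewrite (finite_onE wK (conj Kx wx)) lee_fin.
  have := regular_ge k0 Sne w'le (xi p + (x - Y p)) (conj Kx wx).
  have := near _ (coord _ xs); rewrite ler_norml => /andP[_].
  rewrite -/G -/xi; move: Gw; rewrite -/G -/xi.
  rewrite (_ : x - (xi p + (x - Y p)) = Y p - xi p); last first.
    by apply/rowP => i; rewrite !mxE; ring.
  rewrite /w' /quad; move: (x - Y p) => z; lra.
case: dualA => _; apply.
have -> : - (A + (4 * d)%:M) = - A - t%:M + (4 * d)%:M + (4 * d)%:M.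
  have -> : t = 12 * d by rewrite /d; field.
  by apply/matrixP => i j; rewrite !mxE; case: (i == j); rewrite /= ?mulr1n ?mulr0n; ring.
by apply: sym_interior_add; rewrite // mulr_gt0.
Qed.

Theorem comparison F K D v w :
  cone_subequation F -> compact K -> open D -> D `<=` K ->
  usc_within K v -> usc_within K w -> quad_sub F D v -> quad_sub (dual F) D w ->
  (forall x, K x -> ~ D x -> (v x + w x <= 0)%E) ->
  forall x, D x -> (v x + w x <= 0)%E.
Proof.
move=> Fcone Kc oD DK vK wK subv subw bdry x0 Dx0.
rewrite leNgt; apply/negP => vw0; have Kx0 := DK _ Dx0.
have [vx0 wx0] : finite_on K v x0 /\ finite_on K w x0.
  by move: vw0 (vK.1 x0 Kx0) (wK.1 x0 Kx0); rewrite /finite_on /=;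
    case: (v x0) (w x0) => [a| |] [b| |].
pose m := fine (v x0) + fine (w x0).
have m0 : 0 < m.
  by move: vw0; rewrite (finite_onE vK vx0) (finite_onE wK wx0) -EFinD lte_fin.
have m20 : 0 < m / 2 by rewrite divr_gt0.
have [rho rho0 gap] := boundary_gap Kc oD vK wK m20 bdry.
have [Rb [Rb0 Kb]] : exists Rb, 0 < Rb /\ forall x, K x -> forall i, `|x 0 i| <= Rb.
  have [M [_ HM]] := compact_bounded Kc; exists (`|M| + 1).
  split=> [|x Kx i]; first by rewrite ltr_wpDl.
  apply: le_trans (mx_entry_le _ _ _) _; apply: HM => //.
  by apply: le_lt_trans (ler_norm _) _; rewrite ltrDl.
have [V leV] := usc_bounded_above Kc vK; have [W leW] := usc_bounded_above Kc wK.
(* Over the whole box of slopes, t and r cost at most m / 2 in the maximum, and k makes the penalty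
   force |X p - Y p| <= rho. *)
pose t := m / (4 * (n%:R * (Rb * Rb) + 1)).
pose r := m / (16 * (n%:R * Rb + 1)).
pose k := (`|V| + `|W| + 1) / rho ^+ 2.
have t0 : 0 < t by rewrite divr_gt0 // mulr_gt0 // ltr_wpDl // !mulr_ge0 // ltW.
have r0 : 0 < r by rewrite divr_gt0 // mulr_gt0 // ltr_wpDl // !mulr_ge0 // ltW.
have k0 : 0 < k by rewrite divr_gt0 ?exprn_gt0 // ltr_wpDl // addr_ge0.
have tm : t / 2 * (n%:R * (Rb * Rb)) <= m / 8.
  have c0 : 0 < 4 * (n%:R * (Rb * Rb) + 1).
    by rewrite mulr_gt0 // ltr_wpDl // !mulr_ge0 // ltW.
  have -> : m = t * (4 * (n%:R * (Rb * Rb) + 1)) by rewrite /t divfK // gt_eqF.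
  by clear - t0; lra.
have rm : n%:R * (r * Rb) <= m / 16.
  have c0 : 0 < 16 * (n%:R * Rb + 1).
    by rewrite mulr_gt0 // ltr_wpDl // !mulr_ge0 // ltW.
  have -> : m = r * (16 * (n%:R * Rb + 1)) by rewrite /r divfK // gt_eqF.
  by clear - r0; lra.
pose q p (xy : 'rV[R]_n * 'rV[R]_n) := t / 2 * dot xy.1 xy.1
  - k * dot (xy.1 - xy.2) (xy.1 - xy.2) - 2^-1 * dot p (xy.1 + xy.2).
have qc p : continuous (q p).
  have c1 : coord_cont (fun xy : 'rV[R]_n * 'rV[R]_n => xy.1).
    by apply: continuous_coord_cont => -[x y]; exact: cvg_fst.
  have c2 : coord_cont (fun xy : 'rV[R]_n * 'rV[R]_n => xy.2).
    by apply: continuous_coord_cont => -[x y]; exact: cvg_snd.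
  have d1 := dot_continuous c1 c1.
  have c12 := coord_contD c1 (coord_contN c2).
  have d2 := dot_continuous c12 c12.
  have d3 := dot_continuous (@coord_cont_cst _ _ _ p) (coord_contD c1 c2).
  move=> xy; exact: cvgB (cvgB (cvgM (cvg_cst _) (d1 xy)) (cvgM (cvg_cst _) (d2 xy)))
    (cvgM (cvg_cst _) (d3 xy)).
have [XY XYP] := choice (fun p => doubled_max Kc vK wK (qc p) vx0 wx0).
pose X p := (XY p).1; pose Y p := (XY p).2.
pose box p := forall i : 'I_n, 0 <= p 0 i <= r.
have key p : box p ->
    m / 2 + k * dot (X p - Y p) (X p - Y p) <= fine (v (X p)) + fine (w (Y p)).
  move=> bp; have [Xp Yp /(_ x0 x0 vx0 wx0)] := XYP p.
  rewrite /q /= -/(X p) -/(Y p) subrr !dotE -/m.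
  have pr i : `|p 0 i| <= r by case/andP: (bp i) => ? ?; rewrite ger0_norm.
  have := dot_le (Kb _ Xp.1) (Kb _ Xp.1) => /ler_normlP[_ XX].
  have := dot_le pr (Kb _ Xp.1) => /ler_normlP[pX _].
  have := dot_le pr (Kb _ Yp.1) => /ler_normlP[pY _].
  have := dot_le pr (Kb _ Kx0) => /ler_normlP[_ px0].
  have tX : t / 2 * dot (X p) (X p) <= m / 8.
    by apply: le_trans tm; rewrite ler_wpM2l // divr_ge0 // ltW.
  have tx0 : 0 <= t / 2 * dot x0 x0 by rewrite mulr_ge0 ?dot_ge0 // divr_ge0 // ltW.
  move: pX pY px0 tX tx0 rm; rewrite -/(X p) -/(Y p); clear - m0.
  rewrite !(dotC (Y p) (X p)).
  lra.
have XYrho p : box p -> `|X p - Y p| <= rho.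
  move=> bp; have [Xp Yp _] := XYP p.
  have := leV _ Xp.1; have := leW _ Yp.1.
  rewrite (finite_onE vK Xp) (finite_onE wK Yp) !lee_fin => wW vV.
  have kd : k * dot (X p - Y p) (X p - Y p) <= `|V| + `|W| + 1.
    have := key p bp; have := ler_norm V; have := ler_norm W.
    by move: wW vV m0; rewrite -/(X p) -/(Y p); clear; lra.
  rewrite -(ler_pXn2r (ltn0Sn 1)) ?nnegrE ?(ltW rho0) //.
  apply: le_trans (sqr_norm_le_dot _) _; rewrite -(ler_pM2l k0).
  by rewrite /k divfK // expf_neq0 // gt_eqF.
(* A point of K outside D within 2 rho of both X p and Y p would give v (X p) + w (Y p) < m / 2 by
   [gap], against [key]. *)
have far p x : box p -> K x -> `|X p - x| <= 2 * rho -> `|Y p - x| <= 2 * rho -> D x.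
  move=> bp Kx Xx Yx; apply: contrapT => nDx; have [Xp Yp _] := XYP p.
  have := gap x Kx nDx _ _ Xp.1 Yp.1 Xx Yx.
  rewrite (finite_onE vK Xp) (finite_onE wK Yp) -EFinD lte_fin ltNge => /negP; apply.
  apply: le_trans (key p bp); rewrite lerDl mulr_ge0 ?dot_ge0 //.
  exact: ltW.
apply: (@doubling_contradiction F K D v w k t r rho X Y) => //.
- by move=> p _; case: (XYP p).
- by move=> p _; case: (XYP p).
- move=> p x y _ vx wy; have [_ _ /(_ x y vx wy)] := XYP p.
  by rewrite /q /doubled /= -/(X p) -/(Y p); lra.
- move=> p x bp Kx xX; apply: (far p x bp Kx).
    by rewrite distrC; lra.
  have -> : Y p - x = - (X p - Y p) - (x - X p).
    by apply/rowP => i; rewrite !mxE; ring.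
  by apply: le_trans (ler_normB _ _) _; rewrite normrN; have := XYrho p bp; lra.
- move=> p x bp Kx xY; apply: (far p x bp Kx); last by rewrite distrC; lra.
  have -> : X p - x = (X p - Y p) - (x - Y p).
    by apply/rowP => i; rewrite !mxE; ring.
  by apply: le_trans (ler_normB _ _) _; have := XYrho p bp; lra.
Qed.

End ComparisonPrinciple.

(** * Affine rescaling of semicontinuous and subharmonic functions *)

Section Rescaling.
Variables (R : realType) (n : nat).
Implicit Types (u : 'rV[R]_n -> \bar R) (K D : set 'rV[R]_n).

Lemma rescale_lt (a b t : R) (e : \bar R) : 0 < a -> e != +oo%E ->
  (a%:E * e + b%:E < t%:E)%E = (e < ((t - b) / a)%:E)%E.
Proof.
move=> a0; case: e => [r| |] // _; last by rewrite gt0_muleNy // addNye !ltNyr.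
by rewrite -EFinM -EFinD !lte_fin ltr_pdivlMr // ltrBrDr mulrC.
Qed.

Lemma rescale_le (a b t : R) (e : \bar R) : 0 < a -> e != +oo%E ->
  (a%:E * e + b%:E <= t%:E)%E = (e <= ((t - b) / a)%:E)%E.
Proof.
move=> a0; case: e => [r| |] // _; last by rewrite gt0_muleNy // addNye !leNye.
by rewrite -EFinM -EFinD !lee_fin ler_pdivlMr // lerBrDr mulrC.
Qed.

Lemma usc_within_rescale (a b : R) K u : 0 < a -> usc_within K u ->
  usc_within K (fun x => a%:E * u x + b%:E)%E.
Proof.
move=> a0 [uy uK]; split=> [x Kx|x Kx t].
  by case: (u x) (uy x Kx) => // _; rewrite gt0_muleNy.
rewrite rescale_lt ?uy // => /(uK x Kx); apply: filterS => z uz Kz.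
by rewrite rescale_lt ?uy //; apply: uz.
Qed.

Lemma quad_sub_rescale (a b : R) (F : set 'M[R]_n) D u :
  cone_subequation F -> 0 < a -> (forall x, D x -> u x != +oo%E) ->
  quad_sub F D u -> quad_sub F D (fun x => a%:E * u x + b%:E)%E.
Proof.
move=> [_ _ _ Fcone] a0 uy sub x0 Dx0 A l c sA ux0 near_x0.
have an0 : a != 0 by rewrite gt_eqF.
have -> : A = a *: (a^-1 *: A) by rewrite scalerA divff // scale1r.
apply: Fcone => //; apply: (sub x0 Dx0 _ (a^-1 *: l) ((c - b) / a)).
- by rewrite linearZ /= sA.
- case: (u x0) ux0 (uy x0 Dx0) => [r| |] //; last by rewrite gt0_muleNy.
  rewrite -EFinM -EFinD => -[<-] _; congr EFin; by rewrite addrK mulrC mulKf.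
apply: filterS near_x0 => x uq Dx; have := uq Dx.
rewrite rescale_le ?uy //; congr (_ <= _%:E)%E.
by rewrite /quad -scalemxAr !dotZl; field.
Qed.

End Rescaling.

(** * Removal of the poles *)

Theorem theorem5p2 (R : realType) (n : nat) (F : set 'M[R]_n)
  (Omega : set 'rV[R]_n) (k : nat) (x : 'I_k -> 'rV[R]_n)
  (U : 'I_k -> set 'rV[R]_n) (h : 'I_k -> 'rV[R]_n -> \bar R)
  (v w : 'rV[R]_n -> \bar R) :
  cone_subequation F ->
  open Omega -> connected Omega -> bounded_set Omega -> Omega !=set0 ->
  injective x -> (forall j, Omega (x j)) ->
  (forall j, singular_polar F (x j) (U j) (h j)) ->
  usc_on (closure Omega `\` range x) v ->
  usc_on (closure Omega `\` range x) w ->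
  subharmonic F (Omega `\` range x) v ->
  subharmonic (dual F) (Omega `\` range x) w ->
  (forall j, exists c : R, \forall y \near x j,
      y != x j -> (v y <= h j y + c%:E)%E) ->
  (forall j, exists c : R, \forall y \near x j,
      y != x j -> (w y <= - h j y + c%:E)%E) ->
  (forall y, (closure Omega `\` Omega) y -> (v y + w y <= 0)%E) ->
  forall y, (Omega `\` range x) y -> (v y + w y <= 0)%E.
Proof.
move=> Fcone oO _ bO _ _ Ox hpolar vusc wusc vsub wsub vh wh bdry y0 [Oy0 ry0].
pose X := closure Omega `\` range x.
have vX : usc_within X v by [].
have wX : usc_within X w by [].
have OX : Omega `\` range x `<=` X by move=> y [/subset_closure].
have cOc : compact (closure Omega).
  apply: bounded_closed_compact; last exact: closed_closure.
  case: bO => M [Mr HM]; exists M; split=> // r Mlt.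
  have sub : Omega `<=` closed_ball_ Num.norm 0 r.
    by move=> y Oy; rewrite /closed_ball_ /= sub0r normrN; exact: HM.
  move=> y /(closureS sub).
  rewrite -(closure_id _).1; last exact: closed_closed_ball_.
  by rewrite /closed_ball_ /= sub0r normrN.
have bdX y : (closure Omega `\` Omega) y -> X y.
  by move=> [cy nOy]; split=> // -[j _ xy]; apply: nOy; rewrite -xy.
(* On the boundary (1 + s) v - s M + w = (v + w) + s (v - M) stays nonpositive. *)
have [M vM] : exists M : R, forall y, (closure Omega `\` Omega) y -> (v y <= M%:E)%E.
  apply: usc_bounded_above; last exact: usc_within_sub vX.
  by apply: compact_closedI => //; exact: open_closedC.
have Xy0 : X y0 by apply: OX.
have := vX.1 _ Xy0; have := wX.1 _ Xy0.
case vy0: (v y0) => [a| |] //; last by rewrite addNye leNye.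
case wy0: (w y0) => [b| |] // _ _; last by rewrite addeNy leNye.
suff main (s : R) : 0 < s -> a + b <= s * (M - a).
  rewrite -EFinD lee_fin; apply/ler_addgt0Pr => e e0; rewrite add0r.
  have c0 : 0 < `|M - a| + 1 by rewrite ltr_wpDl.
  apply: le_trans (main (e / (`|M - a| + 1)) _) _; first by rewrite divr_gt0.
  rewrite mulrAC ler_pdivrMr // ler_wpM2l ?(ltW e0) //.
  by apply: le_trans (ler_norm _) _; rewrite lerDl.
(* (1 + s) v - s M + w tends to -oo at each pole, since it is at most
   s h_j + O(1) there. *)
move=> s0; have s10 : 0 < 1 + s by rewrite ltr_wpDr // ltW.
pose vs y := ((1 + s)%:E * v y + (- (s * M))%:E)%E.
have near_pole j : \forall y \near x j, y != x j -> (vs y + w y <= 0)%E.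
  have [c vc] := vh j; have [c' wc'] := wh j.
  have [oU [Uj [hc [hsub [_ [hxj hN]]]]]] := hpolar j.
  have nU : nbhs (x j) (U j) by apply: open_nbhs_nbhs.
  (* In (1 + s) (h_j + c) - s M - h_j + c' only s h_j survives, and h_j < L makes the sum
     negative. *)
  pose L := - ((1 + s) * c - s * M + c') / s.
  have hL : \forall y \near x j, U j y -> (h j y < L%:E)%E.
    by apply: hsub.1.2 => //; rewrite hxj ltNyr.
  near=> y => yx.
  have Uy : U j y by near: y.
  have : (h j y < L%:E)%E by move: Uy; near: y.
  have : (v y <= h j y + c%:E)%E by move: yx; near: y.
  have : (w y <= - h j y + c'%:E)%E by move: yx; near: y.
  rewrite /vs; case: (h j y) (hsub.1.1 y Uy) (hN y Uy yx) => [r| |] // _ _.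
  case: (w y) => [q| |] //; last by rewrite addeNy leNye.
  case: (v y) => [p| |] //; last by rewrite gt0_muleNy // !addNye leNye.
  rewrite -EFinM -!EFinD !lee_fin lte_fin ltr_pdivlMr // => qr pr rL.
  have := ler_wpM2l (ltW s10) pr; lra.
(* The radii are also below |y0 - x j|, so that y0 survives the excision. *)
have /choice[e eP] : forall j, exists e : R, [/\ 0 < e, e < `|y0 - x j| &
    forall y, `|y - x j| <= e -> y != x j -> (vs y + w y <= 0)%E].
  move=> j; have [d /= d0 dP] : nbhs_ball (x j) (fun y => y != x j -> (vs y + w y <= 0)%E).
    by apply/nbhs_ballP; exact: near_pole.
  have y0j : 0 < `|y0 - x j|.
    by rewrite normr_gt0 subr_eq0; apply/eqP => y0E; apply: ry0; exists j.
  exists (Num.min (d / 2) (`|y0 - x j| / 2)); split.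
  - by rewrite lt_min !divr_gt0.
  - by rewrite gt_min; apply/orP; right; lra.
  move=> y ye; apply: dP; rewrite -ball_normE /= distrC.
  by apply: le_lt_trans ye _; rewrite gt_min; apply/orP; left; lra.
pose K := closure Omega `&` [set y | forall j, e j <= `|y - x j|].
pose D := Omega `&` [set y | forall j, e j < `|y - x j|].
have dist_cont j : continuous (fun y : 'rV[R]_n => `|y - x j|).
  by move=> y; exact: cvg_norm (cvgB cvg_id (cvg_cst _)).
have Kc : compact K.
  apply: compact_closedI => //.
  have -> : [set y | forall j, e j <= `|y - x j|] =
      \bigcap_(j in [set: 'I_k]) [set y | e j <= `|y - x j|].
    by apply/seteqP; split => y /= yj j => [_|]; exact: yj.
  apply: closed_bigI => j _.
  by apply: (preimage_closed _ (@closed_ge _ (e j))) => y _; exact: dist_cont.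
have oD : open D.
  rewrite openE => y [Oy yD]; apply: filterI; first exact: open_nbhs_nbhs.
  have far j : \forall z \near y, e j < `|z - x j|.
    exact: (cvgr_gt _ (dist_cont j y) _ (yD j)).
  exact: filter_forall far.
have DK : D `<=` K.
  move=> y [Oy yD]; split; first exact: subset_closure.
  by move=> j; apply/ltW/yD.
have KX : K `<=` X.
  move=> y [cy yK]; split=> // -[j _ xy]; have := yK j.
  by have [e0 _ _] := eP j; rewrite /= xy subrr normr0 leNgt e0.
have DX : D `<=` Omega `\` range x.
  by move=> y Dy; split; [case: Dy|case: (KX _ (DK _ Dy))].
have vK := usc_within_sub KX vX; have wK := usc_within_sub KX wX.
have vsK : usc_within K vs by apply: usc_within_rescale.
have subv : quad_sub F D vs.
  apply: quad_sub_rescale => //; first by move=> y /DK/vK.1.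
  exact: quad_sub_open DX (subharmonic_quad_sub vsub).
have subw : quad_sub (dual F) D w.
  exact: quad_sub_open DX (subharmonic_quad_sub wsub).
(* A point of K outside D lies on the boundary of Omega or on a sphere |y - x j| = e j. *)
have vsw y : K y -> ~ D y -> (vs y + w y <= 0)%E.
  move=> Ky nDy; have [Oy|nOy] := pselect (Omega y); last first.
    have by_ : (closure Omega `\` Omega) y by split => //; case: Ky.
    have := bdry y by_; have := vM y by_; rewrite /vs.
    case: (v y) (vX.1 _ (KX _ Ky)) => [p| |] // _; last first.
      by rewrite gt0_muleNy // !addNye.
    case: (w y) (wX.1 _ (KX _ Ky)) => [q| |] // _.
    rewrite -EFinM -!EFinD !lee_fin => pM pq.
    by have := ler_wpM2l (ltW s0) pM; lra.
  have [j nj] : exists j, ~ (e j < `|y - x j|).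
    by apply: contrapT => nj; apply: nDy; split=> // j; apply: contrapT => ?; apply: nj; exists j.
  have [_ _ ej] := eP j; apply: ej; first by rewrite leNgt; exact/negP.
  by apply/eqP => yx; case: (KX _ Ky) => _; apply; exists j.
have Dy0 : D y0 by split=> // j; have [] := eP j.
have := comparison Fcone Kc oD DK vsK wK subv subw vsw Dy0.
by rewrite /vs vy0 wy0 -EFinM -!EFinD lee_fin; lra.
Unshelve. all: by end_near. Qed.
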